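(* For a semiring $S$ the following conditions are equivalent: (1) $S$ is a simple semiring all of whose finitely generated left semimodules are e-injective. (2) $S$ is a simple semiring all of whose cyclic left semimodules are e-injective. (3) $S$ is isomorphic either to a matrix semiring $M_n(D)$ for some division ring $D$ and $n\ge 1$, or to an endomorphism semiring $\mathrm{End}(L)$ of a nonzero finite distributive lattice $L$.
   Context: A semiring is $(S,+,\cdot,0,1)$ with $(S,+,0)$ a commutative monoid, $(S,\cdot,1)$ a monoid, multiplication distributing over addition on both sides, and $0s=0=s0$ for all $s$. $S$ is congruence-simple if its only semiring congruences are the diagonal and the universal one; ideal-simple if it has exactly two (two-sided) ideals, namely $0$ and $S$; simple if it is both congruence-simple and ideal-simple. For a finite distributive lattice $L$ with least element $0$ (nonzero means $L\neq\{0\}$), $\mathrm{End}(L)$ is the semiring of all endomorphisms of the commutative monoid $(L,\vee,0)$, with pointwise join as addition and composition as multiplication. A left $S$-semimodule is a commutative monoid $(M,+,0)$ with a scalar multiplication $S\times M\to M$ satisfying $(ss')m=s(s'm)$, $s(m+m')=sm+sm'$, $(s+s')m=sm+s'm$, $1m=m$, $s0=0=0m$. Homomorphisms preserve $+$, $0$ and scalar multiplication; ${}_S\mathcal{M}$ is the category of left $S$-semimodules and $\mathcal{M}$ the category of commutative monoids. A semimodule is cyclic (finitely generated) if it is a homomorphic image of ${}_SS$ (of $({}_SS)^n$ for some finite $n$). A sequence $0\to A\xrightarrow{f}B\xrightarrow{g}C\to 0$ in ${}_S\mathcal{M}$ (or in $\mathcal{M}$) is short exact if $f$ is a categorical kernel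 of $g$ and $g$ is a categorical cokernel of $f$ (kernels and cokernels in the sense of categories with zero morphisms). $M\in{}_S\mathcal{M}$ is e-injective if the contravariant functor $\mathrm{Hom}_S(-,M):{}_S\mathcal{M}\to\mathcal{M}$ sends every short exact sequence $0\to A\to B\to C\to 0$ to a short exact sequence $0\to\mathrm{Hom}_S(C,M)\to\mathrm{Hom}_S(B,M)\to\mathrm{Hom}_S(A,M)\to 0$ in $\mathcal{M}$. *)

(* Defs.v *)
From HB Require Import structures.
From mathcomp Require Import all_boot all_order all_algebra.
From mathcomp Require Import boolp classical_sets.

Set Implicit Arguments.
Unset Strict Implicit.
Unset Printing Implicit Defensive.

Import Order.TTheory GRing.Theory.
Local Open Scope ring_scope.

Section Simplicity.
Variable S : pzSemiRingType.

Definition congruence (r : S -> S -> Prop) : Prop :=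
  [/\ forall x, r x x,
      forall x y, r x y -> r y x,
      forall x y z, r x y -> r y z -> r x z,
      forall x x' y y', r x x' -> r y y' -> r (x + y) (x' + y')
    & forall x x' y y', r x x' -> r y y' -> r (x * y) (x' * y')].

Definition congruence_simple : Prop :=
  forall r, congruence r -> (forall x y, r x y <-> x = y) \/ (forall x y, r x y).

Definition ideal (I : set S) : Prop :=
  [/\ I 0,
      forall x y, I x -> I y -> I (x + y),
      forall s x, I x -> I (s * x)
    & forall s x, I x -> I (x * s)].

(* The set of ideals is {{0}, S} and it has two elements. *)
Definition ideal_simple : Prop :=
  (forall I : set S, ideal I <-> I = [set 0]%classic \/ I = setT) /\
  [set 0]%classic <> [set: S]%classic.

Definition simple : Prop := congruence_simple /\ ideal_simple.

End Simplicity.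

Definition semiring_isomorphic (S T : pzSemiRingType) : Prop :=
  exists f : {rmorphism S -> T}, bijective f.

(* MathComp has no structure of (possibly noncommutative) division rings;
   1 != 0 is part of nzRingType. *)
Definition division_ring (D : nzRingType) : Prop :=
  forall x : D, x != 0 -> exists y, x * y = 1 /\ y * x = 1.

(* finTBDistrLatticeType is the structure of nonempty finite distributive
   lattices; finiteness makes the top element automatic, and the monoid
   endomorphisms of (L, join, bottom) are not required to preserve it. *)
Section EndLattice.
Import Order.Syntax.
Context (d : Order.disp_t) (L : finTBDistrLatticeType d).

Definition join_endo (f : {ffun L -> L}) : bool :=
  (f \bot == \bot)%O && [forall x, [forall y, f (x `|` y)%O == (f x `|` f y)%O]].

Record End : Type := MkEnd { End_fun :> {ffun L -> L}; _ : join_endo End_fun }.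

HB.instance Definition _ := [isSub for End_fun].
HB.instance Definition _ := [Choice of End by <:].

Lemma join_endoP (f : {ffun L -> L}) :
  reflect (f \bot = \bot /\ forall x y, f (x `|` y) = f x `|` f y)%O (join_endo f).
Proof.
apply: (iffP andP) => [[/eqP f0 /forallP fU]|[f0 fU]]; split=> //.
- by move=> x y; apply/eqP; have /forallP := fU x; apply.
- exact/eqP.
- by apply/forallP => x; apply/forallP => y; apply/eqP.
Qed.

Lemma EndP (f : End) : (f \bot = \bot /\ forall x y, f (x `|` y) = f x `|` f y)%O.
Proof. exact/join_endoP/(valP f). Qed.

Fact End_zero_subproof : join_endo [ffun=> \bot%O].
Proof. by apply/join_endoP; split=> [|x y]; rewrite !ffunE ?joinxx. Qed.

Fact End_add_subproof (f g : End) : join_endo [ffun x => (f x `|` g x)%O].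
Proof.
have [f0 fU] := EndP f; have [g0 gU] := EndP g.
by apply/join_endoP; split=> [|x y]; rewrite !ffunE ?f0 ?g0 ?joinxx // fU gU joinACA.
Qed.

Fact End_one_subproof : join_endo [ffun x => x].
Proof. by apply/join_endoP; split=> [|x y]; rewrite !ffunE. Qed.

Fact End_mul_subproof (f g : End) : join_endo [ffun x => f (g x)].
Proof.
have [f0 fU] := EndP f; have [g0 gU] := EndP g.
by apply/join_endoP; split=> [|x y]; rewrite !ffunE ?g0 ?f0 // gU fU.
Qed.

Definition End_zero : End := MkEnd End_zero_subproof.
Definition End_add (f g : End) : End := MkEnd (End_add_subproof f g).
Definition End_one : End := MkEnd End_one_subproof.
Definition End_mul (f g : End) : End := MkEnd (End_mul_subproof f g).

Lemma End_eq (f g : End) : (forall x, f x = g x) -> f = g.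
Proof. by move=> fg; apply/val_inj/ffunP. Qed.

Fact End_addA : associative End_add.
Proof. by move=> f g h; apply: End_eq => x; rewrite !ffunE joinA. Qed.
Fact End_addC : commutative End_add.
Proof. by move=> f g; apply: End_eq => x; rewrite !ffunE joinC. Qed.
Fact End_add0 : left_id End_zero End_add.
Proof. by move=> f; apply: End_eq => x; rewrite !ffunE join0x. Qed.

HB.instance Definition _ := GRing.isNmodule.Build End End_addA End_addC End_add0.

Fact End_mulA : associative End_mul.
Proof. by move=> f g h; apply: End_eq => x; rewrite !ffunE. Qed.
Fact End_mul1l : left_id End_one End_mul.
Proof. by move=> f; apply: End_eq => x; rewrite !ffunE. Qed.
Fact End_mul1r : right_id End_one End_mul.
Proof. by move=> f; apply: End_eq => x; rewrite !ffunE. Qed.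
Fact End_mulDl : left_distributive End_mul +%R.
Proof. by move=> f g h; apply: End_eq => x; rewrite !ffunE. Qed.
Fact End_mulDr : right_distributive End_mul +%R.
Proof.
by move=> f g h; apply: End_eq => x; rewrite !ffunE; have [_ ->] := EndP f.
Qed.
Fact End_mul0l : left_zero 0 End_mul.
Proof. by move=> f; apply: End_eq => x; rewrite !ffunE. Qed.
Fact End_mul0r : right_zero 0 End_mul.
Proof. by move=> f; apply: End_eq => x; rewrite !ffunE; have [-> _] := EndP f. Qed.

HB.instance Definition _ := GRing.Nmodule_isPzSemiRing.Build End
  End_mulA End_mul1l End_mul1r End_mulDl End_mulDr End_mul0l End_mul0r.

End EndLattice.

Section CommutativeMonoids.
Context (A B C : nmodType).

Definition mon_kernel (f : {additive A -> B}) (g : {additive B -> C}) : Prop :=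
  (forall a, g (f a) = 0) /\
  forall (X : nmodType) (h : {additive X -> B}), (forall x, g (h x) = 0) ->
    exists! k : {additive X -> A}, forall x, f (k x) = h x.

Definition mon_cokernel (f : {additive A -> B}) (g : {additive B -> C}) : Prop :=
  (forall a, g (f a) = 0) /\
  forall (X : nmodType) (h : {additive B -> X}), (forall a, h (f a) = 0) ->
    exists! k : {additive C -> X}, forall b, k (g b) = h b.

Definition mon_short_exact (f : {additive A -> B}) (g : {additive B -> C}) : Prop :=
  mon_kernel f g /\ mon_cokernel f g.

End CommutativeMonoids.

Section Semimodules.
Variable S : pzSemiRingType.

Section ShortExact.
Context (A B C : lSemiModType S).

Definition kernel (f : {linear A -> B}) (g : {linear B -> C}) : Prop :=
  (forall a, g (f a) = 0) /\
  forall (X : lSemiModType S) (h : {linear X -> B}), (forall x, g (h x) = 0) ->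
    exists! k : {linear X -> A}, forall x, f (k x) = h x.

Definition cokernel (f : {linear A -> B}) (g : {linear B -> C}) : Prop :=
  (forall a, g (f a) = 0) /\
  forall (X : lSemiModType S) (h : {linear B -> X}), (forall a, h (f a) = 0) ->
    exists! k : {linear C -> X}, forall b, k (g b) = h b.

Definition short_exact (f : {linear A -> B}) (g : {linear B -> C}) : Prop :=
  kernel f g /\ cokernel f g.

End ShortExact.

Section Hom.
Context (A M : lSemiModType S).

Definition Hom : Type := {linear A -> M}.

(* Every nmodType carries a choice structure; for an arbitrary hom-set it has to
   be taken from classical choice. *)
HB.instance Definition _ := gen_eqMixin Hom.
HB.instance Definition _ := gen_choiceMixin Hom.

Lemma Hom_eq (f g : {linear A -> M}) : f =1 g -> f = g.
Proof.
case: f g => [f [[f1] [f2]]] [g [[g1] [g2]]] /= /funext fg.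
rewrite /= in fg; subst g.
by congr (GRing.Linear.Pack (GRing.Linear.Class _ _)); congr (_ _); exact: Prop_irrelevance.
Qed.

Definition Hom_zero : Hom := (\0 : A -> M) : {linear A -> M}.
Definition Hom_add (f g : Hom) : Hom :=
  ((f : {linear A -> M}) \+ (g : {linear A -> M}) : A -> M) : {linear A -> M}.

Fact Hom_addA : associative Hom_add.
Proof. by move=> f g h; apply: Hom_eq => x /=; rewrite addrA. Qed.
Fact Hom_addC : commutative Hom_add.
Proof. by move=> f g; apply: Hom_eq => x /=; rewrite addrC. Qed.
Fact Hom_add0 : left_id Hom_zero Hom_add.
Proof. by move=> f; apply: Hom_eq => x /=; rewrite add0r. Qed.

HB.instance Definition _ := GRing.isNmodule.Build Hom Hom_addA Hom_addC Hom_add0.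

End Hom.

Section HomFunctor.
Context (A B M : lSemiModType S) (f : {linear A -> B}).

Definition Hom_map (h : Hom B M) : Hom A M :=
  ((h : {linear B -> M}) \o f : A -> M) : {linear A -> M}.

Fact Hom_map_is_nmod_morphism : nmod_morphism Hom_map.
Proof. by split=> [|g h]; apply: Hom_eq. Qed.

HB.instance Definition _ :=
  GRing.isNmodMorphism.Build (Hom B M) (Hom A M) Hom_map Hom_map_is_nmod_morphism.

End HomFunctor.

Definition e_injective (M : lSemiModType S) : Prop :=
  forall (A B C : lSemiModType S) (f : {linear A -> B}) (g : {linear B -> C}),
    short_exact f g ->
    mon_short_exact (@Hom_map B C M g : {additive Hom C M -> Hom B M})
                    (@Hom_map A B M f : {additive Hom B M -> Hom A M}).

Definition cyclic (M : lSemiModType S) : Prop :=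
  exists p : {linear S^o -> M}, forall m, exists s, p s = m.

(* (_S S)^n is realized as the left semimodule of row vectors over S. *)
Definition finitely_generated (M : lSemiModType S) : Prop :=
  exists (n : nat) (p : {linear 'rV[S]_n -> M}), forall m, exists v, p v = m.

End Semimodules.

(* Main.v *)
Require Import Defs.
From HB Require Import structures.
From mathcomp Require Import all_boot all_order all_algebra.
From mathcomp Require Import boolp classical_sets.

(* A congruence-simple semiring is a ring or additively idempotent. In both cases
   the point is to find an idempotent [e], with [S e S = S], such that [e S e] is a
   division ring, respectively [{0, e}]: this forces [S] to be a matrix semiring
   over [e S e], respectively [End L] for the lattice [L] of all [s e].
   In a ring, such an [e] exists because cyclic modules are injective (Osofsky).
   In the idempotent case, injectivity of [S] itself provides a top element [e],
   and simplicity gives [e s e = e] for [s <> 0], since [1] is a sum of elements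
   [a s b <= e s e].
   Conversely, [1 = \sum_i u i * e * v i] embeds every semimodule [M] in a finite
   power of [e M], on which homomorphisms are extended by complements in the ring
   case, and by the top element of [e M] outside the (down-closed) subsemimodule
   in the idempotent case. *)

Set Implicit Arguments.
Unset Strict Implicit.
Unset Printing Implicit Defensive.

Import Order.TTheory GRing.Theory.
Local Open Scope ring_scope.

(** The equation [1 = \sum_i u i * e * v i] does the work of a Morita equivalence between [S] and
    its corner: congruences, ideals and semimodules are examined through the entries
    [e * v i * s * u j * e]. Homomorphisms of semimodules are not controlled by their kernels, so
    e-injectivity asks for more than extending homomorphisms: two maps with the same restriction
    must become equal after maps vanishing on the subsemimodule are added to them. Both properties
    are established for the semirings of the classification, whereas only the extension property is
    drawn from the hypothesis on cyclic semimodules. *)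

Lemma additive_eq (A B : nmodType) (f g : {additive A -> B}) : f =1 g -> f = g.
Proof.
case: f g => [f [[f1]]] [g [[g1]]] /= /funext fg; rewrite /= in fg; subst g.
by do ![congr (_ _)]; exact: Prop_irrelevance.
Qed.

Lemma additive_exists (A B : nmodType) (h : A -> B) :
  h 0 = 0 -> (forall x y, h (x + y) = h x + h y) ->
  exists k : {additive A -> B}, k =1 h.
Proof.
move=> h0 hD; have hA : nmod_morphism h by [].
pose k : {additive A -> B} := HB.pack h (GRing.isNmodMorphism.Build A B h hA).
by exists k.
Qed.

Lemma subnmodule_exists (N : nmodType) (P : N -> Prop) :
  P 0 -> (forall x y, P x -> P y -> P (x + y)) ->
  exists (A : nmodType) (i : {additive A -> N}),
    injective i /\ forall x, P x <-> exists a, i a = x.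
Proof.
move=> P0 PD.
have cP : GRing.nmod_closed [pred x : N | `[< P x >]].
  by split=> [|x y]; rewrite !inE //; apply: PD.
pose W := {x : N | x \in [pred x : N | `[< P x >]]}.
pose A : nmodType := HB.pack W (GRing.SubChoice_isSubNmodule.Build N _ W cP).
have [//|//|i iE] := @additive_exists A N val.
exists A, i; split; first by move=> x y; rewrite !iE; exact: val_inj.
move=> x; split=> [Px|[a <-]]; last by rewrite iE; have /asboolP := valP a.
have Px' : x \in [pred x : N | `[< P x >]] by exact/asboolP.
by exists (exist _ x Px'); rewrite iE.
Qed.

(** An epimorphism of commutative monoids need not be surjective (the naturals in the integers). For
    a cokernel, the corestriction of [g] to its image factors as [k] after [g], and uniqueness
    forces [i \o k] to be the identity of [C]. *)
Lemma mon_cokernel_surj (A B C : nmodType) (f : {additive A -> B})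
    (g : {additive B -> C}) :
  mon_cokernel f g -> forall c, exists b, g b = c.
Proof.
case=> gf gU; pose P c := exists b, g b = c.
have [||X [i [iI iP]]] := @subnmodule_exists C P.
- by exists 0; rewrite raddf0.
- by move=> _ _ [x <-] [y <-]; exists (x + y); rewrite raddfD.
have /choice[h hE] b : exists x, i x = g b by apply/iP; exists b.
have [||hm hmE] := @additive_exists B X h.
- by apply: iI; rewrite hE !raddf0.
- by move=> x y; apply: iI; rewrite raddfD !hE raddfD.
have [a|k [kE _]] := gU _ hm; first by apply: iI; rewrite hmE hE gf raddf0.
have [a|l [_ lU]] := gU _ g; first by rewrite gf.
have l_id : l = idfun by apply: lU.
have l_ik : l = i \o k by apply: lU => b /=; rewrite kE hmE hE.
move=> c; apply/iP; exists (k c).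
by have := congr1 (fun u : {additive C -> C} => u c) l_ik; rewrite l_id.
Qed.

(** * Subsemimodules, quotients, and e-injectivity as an extension property *)

Section Infrastructure.
Variable S : pzSemiRingType.
Implicit Types A B C M N : lSemiModType S.

Lemma linear_exists B M (h : B -> M) :
  (forall x y, h (x + y) = h x + h y) -> (forall s x, h (s *: x) = s *: h x) ->
  exists k : {linear B -> M}, k =1 h.
Proof.
move=> hD hZ.
have h0 : nmod_morphism h by split=> //; rewrite -(scale0r 0) hZ scale0r.
pose k : {linear B -> M} :=
  HB.pack h (GRing.isNmodMorphism.Build B M h h0)
            (GRing.isScalable.Build S B M *:%R h hZ).
by exists k.
Qed.

Lemma linear_orbit M (m : M) :
  exists k : {linear S^o -> M}, forall s : S, k s = s *: m.
Proof.
have [s t|s t|k kE] := @linear_exists S^o M (fun s : S => s *: m).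
- by rewrite scalerDl.
- by rewrite scalerA.
by exists k.
Qed.

(** For maps defined through some preimage: linearity is checked on the relation instead of on
    chosen values. *)
Lemma linear_of_graph B M (G : B -> M -> Prop) :
  (forall x, exists m, G x m) -> (forall x m m', G x m -> G x m' -> m = m') ->
  (forall x y m n, G x m -> G y n -> G (x + y) (m + n)) ->
  (forall s x m, G x m -> G (s *: x) (s *: m)) ->
  exists k : {linear B -> M}, forall x, G x (k x).
Proof.
move=> Gt Gf GD GZ; have [h hP] := choice Gt.
have [x y|s x|k kh] := @linear_exists B M h.
- exact: Gf (hP _) (GD _ _ _ _ (hP _) (hP _)).
- exact: Gf (hP _) (GZ _ _ _ (hP _)).
by exists k => x; rewrite kh.
Qed.

Lemma subsemimodule_exists N (P : N -> Prop) :
  P 0 -> (forall x y, P x -> P y -> P (x + y)) -> (forall s x, P x -> P (s *: x)) ->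
  exists (A : lSemiModType S) (i : {linear A -> N}),
    injective i /\ forall x, P x <-> exists a, i a = x.
Proof.
move=> P0 PD PZ.
have cP : GRing.subsemimod_closed [pred x : N | `[< P x >]].
  split; first by split=> [|x y]; rewrite !inE //; apply: PD.
  by move=> s x; rewrite !inE; apply: PZ.
pose W := {x : N | x \in [pred x : N | `[< P x >]]}.
pose A : lSemiModType S :=
  HB.pack W (GRing.SubChoice_isSubLSemiModule.Build S N _ W cP).
have [//|//|i iE] := @linear_exists A N val.
exists A, i; split; first by move=> x y; rewrite !iE; exact: val_inj.
move=> x; split=> [Px|[a <-]]; last by rewrite iE; have /asboolP := valP a.
have Px' : x \in [pred x : N | `[< P x >]] by exact/asboolP.
by exists (exist _ x Px'); rewrite iE.
Qed.

Lemma quotient_exists N (r : N -> N -> Prop) :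
  (forall x, r x x) -> (forall x y, r x y -> r y x) ->
  (forall x y z, r x y -> r y z -> r x z) ->
  (forall x x' y y', r x x' -> r y y' -> r (x + y) (x' + y')) ->
  (forall s x x', r x x' -> r (s *: x) (s *: x')) ->
  exists (Q : lSemiModType S) (p : {linear N -> Q}),
    (forall q, exists x, p x = q) /\ forall x y, p x = p y <-> r x y.
Proof.
move=> rr rs rt rD rZ.
(* Related points have the same class [r x], hence the same chosen representative; the fixed points
   of [rep] carry the quotient. *)
pose rep x := xget 0 (r x).
have repP x : r x (rep x) by rewrite /rep; case: xgetP => // /(_ x (rr x)).
have repE x y : r x y -> rep x = rep y.
  move=> xy; rewrite /rep; suff -> : r x = r y by [].
  by apply/funext => z; apply/propext; split; apply: rt => //; apply: rs.
have repK x : rep (rep x) == rep x by apply/eqP/esym/repE.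
pose W := {x : N | rep x == x}.
pose p x : W := exist _ (rep x) (repK x).
have pE x y : p x = p y <-> r x y.
  split=> [/(congr1 val)/= xy|/repE xy]; last exact/val_inj.
  by apply: rt (repP x) _; rewrite xy; apply/rs/repP.
have pK (q : W) : p (val q) = q by apply/val_inj/eqP/(valP q).
pose add (q q' : W) := p (val q + val q').
pose scale s (q : W) := p (s *: val q).
have pv x : r (val (p x)) x by exact/rs/repP.
have pD x y : p (x + y) = add (p x) (p y) by apply/pE/rs/rD; exact: pv.
have pZ s x : p (s *: x) = scale s (p x) by apply/pE/rs/rZ; exact: pv.
have addA : associative add.
  by move=> x y z; rewrite -(pK x) -(pK y) -(pK z) -!pD addrA.
have addC : commutative add by move=> x y; rewrite -(pK x) -(pK y) -!pD addrC.
have add0 : left_id (p 0) add by move=> x; rewrite -(pK x) -!pD add0r.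
pose Wn := GRing.isNmodule.Build W addA addC add0.
pose Q0 : nmodType := HB.pack W Wn.
have sA a b x : scale a (scale b x) = scale (a * b) x.
  by rewrite -(pK x) -!pZ scalerA.
have s0 x : scale 0 x = p 0 by rewrite -(pK x) -!pZ scale0r.
have s1 : left_id 1 scale by move=> x; rewrite -(pK x) -!pZ scale1r.
have sDr : right_distributive scale add.
  by move=> a x y; rewrite -(pK x) -(pK y) -pD -!pZ -pD scalerDr.
have sDl (x : W) : {morph scale^~ x : a b / a + b >-> add a b}.
  by move=> a b /=; rewrite -(pK x) -!pZ -pD scalerDl.
pose Wl := GRing.Nmodule_isLSemiModule.Build S Q0 sA s0 s1 sDr sDl.
pose Q : lSemiModType S := HB.pack W Wn Wl.
have [x y|s x|k kE] := @linear_exists N Q p; [exact: pD|exact: pZ|].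
exists Q, k; split=> [q|x y]; last by rewrite !kE.
by exists (val q); rewrite kE pK.
Qed.

(* e-injectivity is: extension of homomorphisms from subtractive subsemimodules,
   plus the second condition below, which makes restriction a cokernel in
   commutative monoids and has no counterpart for modules over rings. *)
Lemma e_injective_intro M :
  (forall A B (f : {linear A -> B}), injective f ->
    (forall a a' b, f a + b = f a' -> exists a'', f a'' = b) ->
    (forall h : {linear A -> M}, exists k : {linear B -> M}, forall a, k (f a) = h a) /\
    (forall h h' : {linear B -> M}, (forall a, h (f a) = h' (f a)) ->
      exists k k' : {linear B -> M}, [/\ forall a, k (f a) = 0,
        forall a, k' (f a) = 0 & forall b, h b + k b = h' b + k' b])) ->
  e_injective M.
Proof.
move=> HM A B C f g [[gf gK] [_ gC]].
(* Elements of [A] are homomorphisms from [S^o], so the uniqueness of factorizations through a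
   kernel, tested on [S^o], is injectivity. *)
have fI : injective f.
  move=> a a' faa'; have [k kE] := linear_orbit a; have [k' k'E] := linear_orbit a'.
  have [s|l [_ lU]] := gK _ (f \o k); first exact: gf.
  have := lU k (fun=> erefl); rewrite (lU k') => [kk'|s /=]; last first.
    by rewrite kE k'E !linearZ faa'.
  by rewrite -(scale1r a) -kE -(scale1r a') -k'E kk'.
have fker b : g b = 0 -> exists a, f a = b.
  move=> gb0; have [k kE] := linear_orbit b.
  have [s|l [lE _]] := gK _ k; first by rewrite kE linearZ /= gb0 scaler0.
  by exists (l (1 : S)); rewrite lE kE scale1r.
have [|ext sep] := HM _ _ _ fI.
  by move=> a a' b /(congr1 g); rewrite linearD /= !gf add0r => /fker.
have gE (X : lSemiModType S) (k k' : {linear C -> X}) :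
    (forall b, k (g b) = k' (g b)) -> k = k'.
  move=> kk'; have [a|l [_ lU]] := gC _ (k' \o g); first by rewrite /= gf linear0.
  by rewrite -(lU k) // -(lU k').
split; split.
- by move=> h; apply: Hom_eq => a /=; rewrite gf linear0.
- move=> X h h0.
  have fac x : {k : {linear C -> M} | forall b, k (g b) = h x b}.
    apply/cid; have [a|k [kE _]] := gC _ (h x : {linear _ -> _}); last by exists k.
    by have /(congr1 (fun u : Defs.Hom A M => u a)) := h0 x.
  pose l x : Defs.Hom C M := sval (fac x).
  have lE x b : l x (g b) = h x b by rewrite /l; case: (fac x).
  have [||l' l'E] := @additive_exists X (Defs.Hom C M) l.
  - by apply: gE => b; rewrite lE raddf0.
  - by move=> x y; apply: gE => b; rewrite lE raddfD /= !lE.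
  exists l'; split=> [x|k kE]; first by apply: Hom_eq => b /=; rewrite l'E lE.
  apply: additive_eq => x; rewrite l'E; apply: gE => b; rewrite lE -kE //.
- by move=> h; apply: Hom_eq => a /=; rewrite gf linear0.
- move=> X h h0.
  (* Maps vanishing on [A] factor through [g] and are killed by [h]; the corrections [k] and [k']
     therefore do not change the values of [h]. *)
  have hE (u v : Defs.Hom B M) : (forall a, u (f a) = v (f a)) -> h u = h v.
    move=> /sep[k [k' [k0 k'0 uv]]].
    have h_fac (w : {linear B -> M}) : (forall a, w (f a) = 0) -> h w = 0.
      move=> /gC[w' [w'E _]]; rewrite -(h0 w'); congr (h _).
      by apply: Hom_eq => b /=; rewrite w'E.
    have : h (u + k : Defs.Hom B M) = h (v + k' : Defs.Hom B M).
      by congr (h _); apply: Hom_eq.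
    by rewrite !raddfD /= (h_fac k) // (h_fac k') // !addr0.
  have [e eE] := choice ext.
  have [||l lE] := @additive_exists (Defs.Hom A M) X (h \o e).
  - by rewrite -(raddf0 h); apply: hE => a /=; rewrite eE.
  - by move=> x y /=; rewrite -raddfD; apply: hE => a /=; rewrite !eE.
  exists l; split=> [u|k kE].
    by rewrite lE /=; apply: hE => a; rewrite eE.
  apply: additive_eq => x; rewrite lE /= -kE; congr (k _).
  by apply: Hom_eq => a /=; rewrite eE.
Qed.

(** [r] is the Bourne congruence of the image of [f], whose quotient map [p] is the cokernel of [f].
    Subtractivity makes [f] the kernel of [p], so restriction along [f] is a cokernel and hence
    surjective. *)
Lemma e_injective_extend M A B (f : {linear A -> B}) (h : {linear A -> M}) :
  e_injective M -> injective f ->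
  (forall a a' b, f a + b = f a' -> exists a'', f a'' = b) ->
  exists k : {linear B -> M}, forall a, k (f a) = h a.
Proof.
move=> Minj fI fsub.
pose r x y := exists a a', x + f a = y + f a'.
have [x|x y [a [a' E]]|x y z|x x' y y'|s x x'|Q [p [pS pE]]] := @quotient_exists B r.
- by exists 0, 0.
- by exists a', a.
- move=> [a [a' E]] [c [c' E']]; exists (a + c), (a' + c').
  by rewrite !linearD addrA E addrAC E' -!addrA [f a' + _]addrC.
- move=> [a [a' E]] [c [c' E']]; exists (a + c), (a' + c').
  by rewrite !linearD addrACA E E' addrACA.
- by move=> [a [a' E]]; exists (s *: a), (s *: a'); rewrite !linearZ -!scalerDr E.
have pf a : p (f a) = 0.
  by rewrite -(linear0 p); apply/pE; exists 0, a; rewrite linear0 addr0 add0r.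
have fp b : p b = 0 -> exists a, f a = b.
  rewrite -(linear0 p) => /pE[a [a']]; rewrite add0r addrC; exact: fsub.
have fp_exact : short_exact f p.
  split; split=> //.
  - move=> X u pu.
    have [x|x a a' <-|x y a c E E'|s x a E|v vE] :=
        @linear_of_graph X A (fun x a => f a = u x).
    + exact: fp.
    + by move=> /esym/fI.
    + by rewrite !linearD E E'.
    + by rewrite !linearZ /= E.
    exists v; split=> // w wE; apply: Hom_eq => x; apply: fI.
    by rewrite vE wE.
  - move=> X u uf.
    have [q|q m m'|x y m n|s x m|v vE] :=
        @linear_of_graph Q X (fun q m => exists2 b, p b = q & u b = m).
    + by have [b <-] := pS q; exists (u b), b.
    + move=> [b <- <-] [b' E <-]; have /pE[a [a']] := E.
      by move=> /(congr1 u); rewrite !linearD !uf !addr0.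
    + by move=> [b <- <-] [b' <- <-]; exists (b + b'); rewrite linearD.
    + by move=> [b <- <-]; exists (s *: b); rewrite linearZ.
    have vp b : v (p b) = u b.
      have [b' E <-] := vE (p b); have /pE[a [a']] := E.
      by move=> /(congr1 u); rewrite !linearD !uf !addr0.
    exists v; split=> // w wE; apply: Hom_eq => q.
    by have [b <-] := pS q; rewrite vp wE.
have [_ /mon_cokernel_surj/(_ h)[k kh]] := Minj _ _ _ _ _ fp_exact.
by exists k => a; rewrite -kh.
Qed.

End Infrastructure.

(** * Congruence-simple semirings are rings or additively idempotent *)

(** An equality of structures instead of an isomorphism, so that [subst] turns all that is known
    about [S] into facts about a ring. *)
Lemma pzRing_of_opp (S : pzSemiRingType) :
  (exists x : S, 1 + x = 0) -> exists R : pzRingType, S = R :> pzSemiRingType.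
Proof.
case=> n1 n1E; pose opp (x : S) := n1 * x.
have addNr : left_inverse 0 opp +%R.
  by move=> x; rewrite /opp -{2}(mul1r x) -mulrDl addrC n1E mul0r.
pose R : pzRingType := HB.pack (GRing.PzSemiRing.sort S)
  (GRing.Nmodule_isZmodule.Build S addNr).
by exists R; rewrite {}/R; case: S n1 n1E @opp addNr.
Qed.

(** [le x y] says that some multiple of [x] has [y] as a summand. Mutual [le] is a congruence
    identifying [x] with [x + x]; if it is universal, [1] is a summand of [0]. *)
Lemma ring_or_idempotent (S : pzSemiRingType) :
  congruence_simple S -> (exists x : S, 1 + x = 0) \/ forall x : S, x + x = x.
Proof.
move=> simS; pose le (x y : S) := exists n a, x *+ n = y + a.
have le_trans x y z : le x y -> le y z -> le x z.
  move=> [n [a E]] [m [b E']]; exists (n * m)%N, (b + a *+ m).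
  by rewrite mulrnA E mulrnDl E' addrA.
have leD x x' y y' : le x x' -> le y y' -> le (x + y) (x' + y').
  move=> [n [a E]] [m [b E']].
  exists (n + m)%N, (a + x *+ m + (b + y *+ n)).
  rewrite mulrnDl !mulrnDr E [y *+ n + _]addrC E' !addrA.
  by rewrite -!addrA; congr (_ + _); rewrite [RHS]addrCA; congr (_ + _);
    rewrite [RHS]addrCA.
have leM x x' y y' : le x x' -> le y y' -> le (x * y) (x' * y').
  move=> [n [a E]] [m [b E']]; exists (n * m)%N, (x' * b + a * (y' + b)).
  by rewrite mulrnA -mulrnAl E -mulrnAr E' mulrDl mulrDr addrA.
have le_refl x : le x x by exists 1%N, 0; rewrite addr0.
have [|eq_le|all_le] := simS (fun x y => le x y /\ le y x).
- split=> //.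
  + by move=> x y [].
  + by move=> x y z [xy yx] [yz zy]; split; [exact: le_trans yz|exact: le_trans yx].
  + by move=> x x' y y' [xx' x'x] [yy' y'y]; split; exact: leD.
  + by move=> x x' y y' [xx' x'x] [yy' y'y]; split; exact: leM.
- right=> x; apply/eq_le; split.
  + by exists 1%N, x.
  + by exists 2, 0; rewrite addr0 mulr2n.
- left; have [[n [a E]] _] := all_le 0 1.
  by exists a; rewrite -E mul0rn.
Qed.

(** * Full corners and simplicity *)

Section FullCorner.
Variables (S : pzSemiRingType) (e : S) (n : nat) (u v : 'I_n -> S).
Hypothesis full : 1 = \sum_i u i * e * v i.

(** Inserting [1 = \sum_i u i * e * v i] on both sides of [s] rebuilds [s] from its matrix
    entries. *)
Lemma corner_eq s t :
  (forall i j, e * v i * s * u j * e = e * v i * t * u j * e) -> s = t.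
Proof.
have E x : x = \sum_i \sum_j u i * (e * v i * x * u j * e) * v j.
  rewrite -[LHS]mul1r -[LHS]mulr1 {1}full 2!mulr_suml; apply: eq_bigr => i _.
  by rewrite full mulr_sumr; apply: eq_bigr => j _; rewrite !mulrA.
move=> st; rewrite (E s) (E t); apply: eq_bigr => i _; apply: eq_bigr => j _.
by rewrite st.
Qed.

Lemma corner_neq s t : s <> t ->
  exists i j, e * v i * s * u j * e <> e * v i * t * u j * e.
Proof.
move=> st; apply: contrapT => nst; apply: st; apply: corner_eq => i j.
by apply: contrapT => ne; apply: nst; exists i, j.
Qed.

Lemma corner_decomp (M : lSemiModType S) (x : M) :
  x = \sum_i u i *: (e *: (v i *: x)).
Proof.
by rewrite -{1}[x]scale1r full scaler_suml; apply: eq_bigr => i _; rewrite !scalerA.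
Qed.

(** A nontrivial congruence separates no longer some pair of distinct entries, and a nonzero ideal
    contains a nonzero entry. The hypotheses move this to [e], from which [1] is rebuilt. *)
Lemma corner_simple :
  e <> 0 ->
  (forall s, e * s * e <> 0 -> exists t, t * (e * s * e) = e) ->
  (forall r, congruence r -> forall s t,
     r (e * s * e) (e * t * e) -> e * s * e <> e * t * e -> r e 0) ->
  simple S.
Proof.
move=> e0 ediv econg; split; [move=> r rC|split].
- case: (rC) => rr rs rt rD rM.
  have [[s [t [rst st]]]|nr] := pselect (exists s t, r s t /\ s <> t); last first.
    left=> x y; split=> [rxy|-> //]; apply: contrapT => xy.
    by apply: nr; exists x, y.
  right; have [i [j]] := corner_neq st; rewrite -!mulrA => ne.
  have re0 : r e 0.
    apply: (econg r rC (v i * (s * u j)) (v i * (t * u j))).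
      by do 3![apply: (rM) => //]; apply: rM.
    by rewrite !mulrA in ne *.
  have rx0 x : r x 0.
    rewrite -[x]mulr1 full mulr_sumr.
    elim/big_rec: _ => // i' y _ ry.
    rewrite -[X in r _ X](addr0 0); apply: rD => //.
    rewrite -[X in r _ X](mulr0 x) -[X in r _ (x * X)](mul0r (v i')).
    by rewrite -[X in r _ (x * (X * _))](mulr0 (u i')); do 3![apply: (rM) => //].
  by move=> x y; apply: rt (rx0 x) _; apply/rs/rx0.
- move=> I; split=> [[I0 ID IL IR]|[]->]; last by split.
  + have [[s [Is s0]]|nI] := pselect (exists s, I s /\ s <> 0); last first.
      left; apply/seteqP; split=> x /=; last by move=> ->.
      by move=> Ix; apply: contrapT => x0; apply: nI; exists x.
    right; apply/seteqP; split=> // x _.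
    have [i [j]] := corner_neq s0; rewrite mulr0 !mul0r => ne.
    have [|t tE] := ediv (v i * s * u j); first by rewrite !mulrA.
    have Ie : I e.
      by rewrite -tE; apply/(IL t)/IR; rewrite !mulrA; apply/IR/IL.
    by rewrite -[x]mulr1 full mulr_sumr; elim/big_ind: _ => // k _; apply/IL/IR/IL.
  + split=> [//|x y -> ->|s x ->|s x ->]; rewrite /= ?addr0 ?mulr0 ?mul0r //.
- by move=> E; apply: e0; have : [set: S]%classic e by []; rewrite -E.
Qed.

End FullCorner.

Lemma full_cornerP (S : pzSemiRingType) (e : S) :
  ideal_simple S -> e <> 0 ->
  exists n (u v : 'I_n -> S), 1 = \sum_i u i * e * v i.
Proof.
move=> [idS _] e0.
pose I : set S :=
  [set x | exists l : seq (S * S), x = \sum_(p <- l) p.1 * e * p.2]%classic.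
have /idS[I0|IT] : ideal I.
  split.
  - by exists [::]; rewrite big_nil.
  - by move=> _ _ [l ->] [l' ->]; exists (l ++ l'); rewrite big_cat.
  - move=> s _ [l ->]; exists [seq (s * p.1, p.2) | p <- l].
    by rewrite big_map mulr_sumr; apply: eq_bigr => p _; rewrite !mulrA.
  - move=> s _ [l ->]; exists [seq (p.1, p.2 * s) | p <- l].
    by rewrite big_map mulr_suml; apply: eq_bigr => p _; rewrite !mulrA.
- case: e0; suff : I e by rewrite I0.
  by exists [:: (1, 1)]; rewrite big_seq1 mul1r mulr1.
have [l lE] : I 1 by rewrite IT.
exists (size l), (fun i => (tnth (in_tuple l) i).1), (fun i => (tnth (in_tuple l) i).2).
by rewrite lE big_tnth.
Qed.

Lemma semiring_isomorphic_sym (S T : pzSemiRingType) :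
  semiring_isomorphic S T -> semiring_isomorphic T S.
Proof.
case=> f [g fK gK]; have fI := can_inj fK.
have gn : nmod_morphism g.
  by split=> [|x y]; apply: fI; rewrite ?rmorphD gK ?rmorph0 ?gK.
have gm : monoid_morphism g.
  by split=> [|x y]; apply: fI; rewrite ?rmorphM gK ?rmorph1 ?gK.
pose h : {rmorphism T -> S} := HB.pack g
  (GRing.isNmodMorphism.Build T S g gn) (GRing.isMonoidMorphism.Build T S g gm).
by exists h, f.
Qed.

(* For [S = End L], [e] is the map sending every nonzero element to the top. *)
Definition boolean_corner (S : pzSemiRingType) (e : S) (n : nat) (u v : 'I_n -> S) :=
  [/\ e <> 0, forall s, s + e = e, forall s, e * s * e = 0 \/ e * s * e = e
    & 1 = \sum_i u i * e * v i].

(** * Simplicity and e-injectivity from a Boolean corner *)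

Section BooleanCorner.
Variables (S : pzSemiRingType) (e : S) (n : nat) (u v : 'I_n -> S).
Hypothesis bc : boolean_corner e u v.

Let e0 : e <> 0. Proof. by case: bc. Qed.
Let addxe s : s + e = e. Proof. by case: bc. Qed.
Let ese s : e * s * e = 0 \/ e * s * e = e. Proof. by case: bc. Qed.
Let full : 1 = \sum_i u i * e * v i. Proof. by case: bc. Qed.

(** [e = e + e * e = e * (1 + e) = e * e], as [e] absorbs both [e * e] and [1]. *)
Lemma boolean_corner_idem : e * e = e.
Proof. by have := addxe (e * e); rewrite addrC -{1}[e]mulr1 -mulrDr addxe. Qed.

Let ee := boolean_corner_idem.

Lemma boolean_corner_simple : simple S.
Proof.
apply: corner_simple full e0 _ _ => [s s0|r [_ rs _ _ _] s t].
  by exists 1; rewrite mul1r; case: (ese s).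
by case: (ese s) (ese t) => -> [] -> // /rs.
Qed.

Implicit Types A B M : lSemiModType S.

Lemma boolean_corner_addxx M (x : M) : x + x = x.
Proof.
rewrite -[x]scale1r -scalerDl; congr (_ *: _).
have : \sum_i u i * e * v i + \sum_i u i * e * v i = \sum_i u i * e * v i.
  by rewrite -big_split; apply: eq_bigr => i _ /=; rewrite -mulrDl -mulrDr addxe.
by rewrite -full.
Qed.

Lemma boolean_corner_top M :
  finitely_generated M -> exists w : M, forall m, m + w = w.
Proof.
case=> k [p pS]; exists (p (const_mx e)) => m; have [x <-] := pS m.
by rewrite -linearD; congr (p _); apply/matrixP => i j; rewrite !mxE addxe.
Qed.

(* On [e *: B] the map [k] is [h] where defined, and the top of [e *: M] elsewhere. *)
Lemma boolean_corner_extend M (w : M) A B (f : {linear A -> B})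
    (h : {linear A -> M}) :
  (forall m, m + w = w) -> injective f ->
  (forall a a' b, f a + b = f a' -> exists a'', f a'' = b) ->
  exists k : {linear B -> M}, (forall a, k (f a) = h a) /\
    forall g g' : {linear B -> M}, (forall a, g (f a) = g' (f a)) ->
      forall b, g b + k b = g' b + k b.
Proof.
move=> wtop fI fsub.
have /choice[H HP] y : exists m : M, (forall a, f a = y -> m = h a) /\
    ((forall a, f a <> y) -> m = e *: w).
  have [[a fa]|na] := pselect (exists a, f a = y).
    exists (h a); split=> [a'|/(_ a)//]; rewrite -fa => /fI -> //.
  by exists (e *: w); split=> // a fa; case: na; exists a.
have Hf a y : f a = y -> H y = h a by case: (HP y) => + _; apply.
have Hn y : (forall a, f a <> y) -> H y = e *: w by case: (HP y).
have eB c (y : B) : e *: (c *: y) = e *: (e *: (c *: y)) by rewrite [RHS]scalerA ee.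
have topeM m : e *: m + e *: w = e *: w by rewrite -scalerDr wtop.
have fe a y : e *: y = y -> f a = y -> h a = e *: h a.
  by move=> ey fa; rewrite -linearZ; congr (h _); apply: fI; rewrite linearZ /= fa.
(* Idempotency turns subtractivity into down-closedness: [f a = y + y'] gives [f a + y = f a]. *)
have fD a y y' : f a = y + y' -> exists a', f a' = y.
  by move=> fa; apply: (fsub a a); rewrite fa addrC addrA boolean_corner_addxx.
have H0 : H 0 = 0 by rewrite (Hf 0) linear0.
(* The image of [f] is down-closed and closed under sums, so a sum lies in it exactly when both
   summands do; otherwise both sides are the top [e *: w]. *)
have HD y y' : e *: y = y -> e *: y' = y' -> H (y + y') = H y + H y'.
  move=> ey ey'; have [[a fa]|na] := pselect (exists a, f a = y + y').
    have [b fb] := fD _ _ _ fa; have [|b' fb'] := fD a y' y; first by rewrite addrC.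
    by rewrite (Hf (b + b')) ?linearD ?fb ?fb' // (Hf _ _ fb) (Hf _ _ fb').
  rewrite [LHS]Hn; last by move=> a fa; apply: na; exists a.
  have [[b fb]|nb] := pselect (exists b, f b = y); last first.
    rewrite (Hn y); last by move=> a fa; apply: nb; exists a.
    have [[b' fb']|nb'] := pselect (exists b, f b = y').
      by rewrite (Hf _ _ fb') (fe _ _ ey' fb') addrC topeM.
    rewrite Hn ?boolean_corner_addxx // => a fa; apply: nb'; by exists a.
  rewrite (Hf _ _ fb) (fe _ _ ey fb) (Hn y') ?topeM // => b' fb'; apply: na.
  by exists (b + b'); rewrite linearD fb fb'.
have He y : e *: y = y -> e *: H y = H y.
  move=> ey; have [[a fa]|na] := pselect (exists a, f a = y).
    by rewrite (Hf _ _ fa) -(fe _ _ ey fa).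
  by rewrite Hn ?scalerA ?ee // => a fa; apply: na; exists a.
pose y (b : B) j := e *: (v j *: b).
have ey b j : e *: y b j = y b j by rewrite /y -eB.
(* A scalar acts on the coordinates [y b j] by a matrix with entries [0] or [e]. As [H] respects
   these two scalars, additivity is enough to make it respect the matrix. *)
have Hs b s i : H (y (s *: b) i) = \sum_j (e * v i * s * u j * e) *: H (y b j).
  have cy j : e *: ((e * v i * s * u j * e) *: y b j) = (e * v i * s * u j * e) *: y b j.
    by rewrite scalerA !mulrA ee.
  have -> : y (s *: b) i = \sum_j (e * v i * s * u j * e) *: y b j.
    rewrite /y {1}(corner_decomp full b) !scaler_sumr; apply: eq_bigr => j _.
    by rewrite !scalerA -(mulrA _ e e) ee.
  have Hsum (F : 'I_n -> B) :
      (forall j, e *: F j = F j) -> H (\sum_j F j) = \sum_j H (F j).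
    move=> eF; suff [//] : H (\sum_j F j) = \sum_j H (F j) /\
      e *: (\sum_j F j) = \sum_j F j.
    elim/big_rec2: _ => [|j m z _ [IH ez]]; first by rewrite H0 scaler0.
    by rewrite scalerDr eF ez HD ?eF // IH.
  rewrite Hsum //; apply: eq_bigr => j _.
  have := ese (v i * s * u j); rewrite !mulrA => -[] ->; first by rewrite !scale0r H0.
  by rewrite ey He.
have [b b'|s b|k kE] := @linear_exists S B M (fun b => \sum_i u i *: H (y b i)).
- rewrite -big_split /=; apply: eq_bigr => i _.
  by rewrite -scalerDr -HD // /y !scalerDr.
- under eq_bigr => i _ do rewrite Hs scaler_sumr.
  rewrite exchange_big scaler_sumr; apply: eq_bigr => j _.
  rewrite -[in RHS](He (y b j)) // !scalerA -[s * _ * e]mul1r full !mulr_suml scaler_suml.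
  by apply: eq_bigr => i _; rewrite !scalerA !mulrA.
exists k; split=> [a|g g' gg' b].
- rewrite kE [in RHS](corner_decomp full a) linear_sum; apply: eq_bigr => i _.
  by rewrite linearZ /= (Hf (e *: (v i *: a))) // /y !linearZ.
(* In each coordinate, either [y b i] is in the image of [f], where [g] and [g'] agree, or [k]
   contributes the top, which absorbs both. *)
rewrite kE (corner_decomp full (g b)) (corner_decomp full (g' b)) -!big_split.
apply: eq_bigr => i _ /=; rewrite -!scalerDr; congr (_ *: _).
have gy (l : {linear B -> M}) : e *: (v i *: l b) = l (y b i) by rewrite /y !linearZ.
have [[a fa]|na] := pselect (exists a, f a = y b i); first by rewrite !gy -fa gg'.
by rewrite Hn ?topeM // => a fa; apply: na; exists a.
Qed.

Lemma boolean_corner_e_injective M : finitely_generated M -> e_injective M.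
Proof.
move=> /boolean_corner_top[w wtop].
apply: e_injective_intro => A B f fI fsub; split=> [h|h h' hh'].
  by have [k [kh _]] := boolean_corner_extend h wtop fI fsub; exists k.
(* The extension of the zero map vanishes on the image of [f] and, by the second clause, evens out
   two maps that agree there. *)
have [z zE] := @linear_exists S A M (fun=> 0) (fun _ _ => esym (addr0 0))
  (fun s _ => esym (scaler0 _ s)).
have [k [kf kh]] := boolean_corner_extend z wtop fI fsub.
by exists k, k; split=> [a|a|b]; rewrite ?kf ?zE //; apply: kh.
Qed.

End BooleanCorner.

(** * The Boolean corner of the endomorphism semiring of a lattice *)

Section EndCorner.
Import Order.Syntax.
Context (d : Order.disp_t) (L : finTBDistrLatticeType d).
Implicit Types a b x y : L.

Fact step_subproof a b : join_endo [ffun x => if (x <= a)%O then \bot%O else b].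
Proof.
apply/join_endoP; rewrite !ffunE le0x; split=> // x y; rewrite !ffunE leUx.
by case: (x <= a)%O (y <= a)%O => [] []; rewrite /= ?joinx0 ?join0x ?joinxx.
Qed.
Definition step a b : End L := MkEnd (step_subproof a b).

Lemma stepE a b x : step a b x = if (x <= a)%O then \bot%O else b.
Proof. by rewrite ffunE. Qed.

Lemma End_mulE (f g : End L) x : (f * g) x = f (g x).
Proof. by rewrite ffunE. Qed.

Lemma End_sumE (I : finType) (P : pred I) (F : I -> End L) x :
  (\sum_(i | P i) F i : End L) x = (\join_(i | P i) F i x)%O.
Proof. by elim/big_rec2: _ => [|i y f _ <-]; rewrite !ffunE. Qed.

Definition join_prime b :=
  (b != \bot)%O && [forall x, forall y, (b <= x `|` y)%O ==> (b <= x)%O || (b <= y)%O].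

Lemma join_primeP b :
  reflect (b <> \bot%O /\ forall x y, (b <= x `|` y -> (b <= x) || (b <= y))%O)
    (join_prime b).
Proof.
apply: (iffP andP) => [[/eqP b0 /forallP bP]|[/eqP b0 bP]]; split=> //.
  by move=> x y; have /forallP/(_ y)/implyP := bP x; apply.
by apply/forallP => x; apply/forallP => y; apply/implyP/bP.
Qed.

(** Distributivity enters here: if [x] is below the join of [y] and [z] but below neither, then [x]
    is the join of its meets with [y] and [z], each with fewer elements below it. *)
Lemma join_primes x : (x = \join_(b | join_prime b && (b <= x)) b)%O.
Proof.
have [n] := ubnP #|[set y | y <= x]%O|; elim: n x => // n IHn x xn.
apply/le_anti/andP; split; last by apply/joinsP => b /andP[].
have [xp|] := boolP (join_prime x); first by apply: joins_sup; rewrite ?xp /=.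
rewrite negb_and negbK => /orP[/eqP->|/forallPn[y /forallPn[z]]]; first exact: le0x.
rewrite negb_imply negb_or => /and3P[xyz xy xz].
suff below t : ~~ (x <= t)%O ->
    (x `&` t <= \join_(b | join_prime b && (b <= x)) b)%O.
  by rewrite -{1}(meet_idPl xyz) meetUr leUx !below.
move=> xt; rewrite {1}(IHn (x `&` t)%O).
  apply/joinsP => b /andP[bp]; rewrite lexI => /andP[bx _].
  by apply: (@joins_sup _ _ _ b) => //; rewrite bp.
rewrite ltnS in xn; apply: leq_trans xn; apply/proper_card/properP; split.
  by apply/fintype.subsetP => b; rewrite !inE lexI => /andP[].
by exists x; rewrite !inE ?lexx // lexI lexx.
Qed.

Definition nonabove b : L := (\join_(x | ~~ (b <= x)) x)%O.

(** Join primality keeps the join of all elements not above [b] from being above [b]. *)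
Lemma le_nonabove b x : join_prime b -> (x <= nonabove b)%O = ~~ (b <= x)%O.
Proof.
move=> /join_primeP[b0 bP]; apply/idP/idP => [xb|bx]; last exact: (@joins_sup _ _ _ x).
have : ~~ (b <= nonabove b)%O.
  apply/negP; rewrite /nonabove; elim/big_ind: _ => [|y z yP zP /bP/orP[]//|y /negP//].
  by rewrite lex0 => /eqP.
by apply: contra => bx; apply: le_trans xb.
Qed.

(** For a join prime [b], the product [step \bot b * e * step (nonabove b) \top] sends [x] to [b] if
    [b <= x] and to the bottom otherwise. By [join_primes] these products add up to the identity. *)
Lemma End_boolean_corner : (exists x : L, x <> \bot%O) ->
  exists e n (u v : 'I_n -> End L), boolean_corner e u v.
Proof.
case=> x0 x0n; pose e := step \bot%O \top%O.
have eE x : e x = if x == \bot%O then \bot%O else \top%O by rewrite stepE lex0.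
have t0 : (\top == \bot :> L)%O = false.
  by apply/negP => /eqP tb; apply: x0n; apply/eqP; rewrite -lex0 -tb lex1.
pose A : pred L := join_prime.
exists e, #|A|, (fun i => step \bot%O (enum_val i)),
  (fun i => step (nonabove (enum_val i)) \top%O); split.
- move=> /(congr1 (fun f : End L => f \top%O)).
  by rewrite eE t0 ffunE => /eqP; rewrite t0.
- move=> s; apply: End_eq => x; rewrite ffunE eE.
  case: eqP => [->|_]; last by rewrite joinx1.
  by have [-> _] := EndP s; rewrite joinxx.
- move=> s; have [st|st] := eqVneq (s \top%O) \bot%O; [left|right].
    apply: End_eq => x; rewrite !End_mulE !eE; have [s0 _] := EndP s.
    by rewrite [RHS]ffunE; case: (x =P _) => _; rewrite ?s0 ?st eqxx.
  apply: End_eq => x; rewrite !End_mulE !eE; have [s0 _] := EndP s.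
  by case: (x =P _) => _; rewrite ?s0 ?eqxx // (negbTE st).
apply: End_eq => x; rewrite End_sumE [LHS]ffunE [LHS]join_primes.
pose F b : L := (step \bot%O b * e * step (nonabove b) \top%O) x.
have FE b : join_prime b -> F b = if (b <= x)%O then b else \bot%O.
  move=> bp; rewrite /F !End_mulE eE !stepE le_nonabove //.
  by case: (b <= x)%O; rewrite /= ?t0 ?eqxx lex0 ?t0 ?eqxx.
by rewrite -(big_enum_val (A := A) F) [LHS]big_mkcondr; apply: eq_bigr => b /FE ->.
Qed.

End EndCorner.

Lemma boolean_corner_transport (S T : pzSemiRingType) :
  semiring_isomorphic S T ->
  (exists e n (u v : 'I_n -> S), boolean_corner e u v) ->
  exists e n (u v : 'I_n -> T), boolean_corner e u v.
Proof.
case=> f [g fK gK] [e [n [u [v [e0 et ese full]]]]].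
exists (f e), n, (f \o u), (f \o v); split.
- by move=> fe; apply: e0; apply: (can_inj fK); rewrite fe rmorph0.
- by move=> s; rewrite -(gK s) -rmorphD et.
- move=> s; rewrite -(gK s) -!rmorphM.
  by case: (ese (g s)) => ->; rewrite ?rmorph0; [left|right].
- by rewrite -(rmorph1 f) full rmorph_sum; apply: eq_bigr => i _; rewrite !rmorphM.
Qed.

(* The quotient of [S^o * S^o] by [r] contains [S^o] as the subtractive subsemimodule
   of the classes of the [(m, 0)], and there the class of [(0, 1)] absorbs [S^o];
   a retraction onto [S^o] maps it to the top of [S]. *)
Lemma e_injective_top (S : pzSemiRingType) :
  (forall x : S, x + x = x) -> e_injective (S^o : lSemiModType S) ->
  exists w : S, forall s, s + w = w.
Proof.
move=> idem Sinj.
have zsf (x y : S) : x + y = 0 -> x = 0 /\ y = 0.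
  move=> xy; have x0 : x = 0 by rewrite -[x]addr0 -xy addrA idem.
  by move: xy; rewrite x0 add0r.
pose N : lSemiModType S := (S^o * S^o)%type.
(* A pair [(m, s)] is read as [m + s * oo] with [oo] absorbing [S]: for each [t], either both
   infinite parts vanish and the finite parts agree, or neither vanishes. That sums vanish only
   termwise makes this compatible with addition. *)
pose r (p q : N) := forall t : S,
  (t * (p.2 : S) = 0 <-> t * (q.2 : S) = 0) /\
  (t * (p.2 : S) = 0 -> t * (p.1 : S) = t * (q.1 : S)).
have [p|p q pq t|p q l pq ql t|p p' q q' pp' qq' t|s p p' pp' t|Q [pi [piS piE]]] :=
    @quotient_exists S N r.
- by move=> t; split.
- by have [E1 E2] := pq t; split=> [|/E1/E2 //]; apply: iff_sym.
- have [E1 E2] := pq t; have [E3 E4] := ql t; split; first exact: iff_trans E3.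
  by move=> t0; rewrite E2 // E4 //; apply/E1.
- have [E1 E2] := pp' t; have [E3 E4] := qq' t.
  rewrite /= !mulrDr; split.
    by split=> /zsf[/E1 -> /E3 ->]; rewrite addr0.
  by move=> /zsf[/E2 -> /E4 ->].
- by have [E1 E2] := pp' (t * s); rewrite /= /GRing.scale /= !mulrA.
have [m n|s m|i iE] := @linear_exists S S^o Q (fun m : S^o => pi (m, 0)).
- by rewrite -linearD -[in LHS](addr0 (0 : S)).
- by rewrite -linearZ -[in LHS](mulr0 s).
have [||k ki] := @e_injective_extend S S^o S^o Q i idfun Sinj.
- by move=> m n; rewrite !iE => /piE/(_ 1)[_ /=]; rewrite !mul1r; apply.
- move=> a a' b; have [[c s] <-] := piS b; rewrite !iE -linearD => E.
  have /piE/(_ 1)[/= s0 _] := E; rewrite !mul1r add0r in s0.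
  by exists c; rewrite iE; congr (pi (_, _)); apply/esym/s0.
exists (k (pi (0, 1))) => s.
rewrite -[X in X + _]ki -linearD iE -linearD; congr (k _); apply/piE => t.
rewrite /= !addr0 !add0r mulr1; split=> // ->.
by rewrite !mul0r.
Qed.

(** * From a Boolean corner to a distributive lattice *)

Section RetractLattice.
Import Order.Syntax.

(** On the fixed points of [rho], the join is the union and the meet is [rho] of the intersection.
    Since [rho] preserves unions, distributivity is inherited from the power set. *)
Lemma join_retract_lattice (I : finType) (rho : {set I} -> {set I}) :
  rho finset.set0 = finset.set0 -> (forall A B, rho (A :|: B) = rho A :|: rho B) ->
  (forall A, rho (rho A) = rho A) ->
  exists (d : Order.disp_t) (L : finTBDistrLatticeType d) (i : L -> {set I}),
    [/\ injective i, forall A, rho A = A <-> exists x, i x = A,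
        i \bot%O = finset.set0 & forall x y, i (x `|` y)%O = i x :|: i y].
Proof.
move=> rho0 rhoU rhoK.
have rhoS (A B : {set I}) : A \subset B -> rho A \subset rho B.
  by move=> /finset.setUidPr <-; rewrite rhoU finset.subsetUl.
pose W := {A : {set I} | rho A == A}.
have Wp (x : W) : rho (val x) = val x by apply/eqP/(valP x).
have rhoW (A : {set I}) (x : W) : A \subset val x -> rho A \subset val x.
  by move=> /rhoS; rewrite Wp.
pose mk A : W := exist _ (rho A) (introT eqP (rhoK A)).
have mkP A : rho A = A -> val (mk A) = A by [].
pose le (x y : W) := val x \subset val y.
have le_refl : reflexive le by move=> x; apply: subxx.
have le_anti : antisymmetric le.
  by move=> x y xy; apply/val_inj/eqP; rewrite finset.eqEsubset.
have le_trans : transitive le by move=> y x z; apply: fintype.subset_trans.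
have d : Order.disp_t by split; exact: tt.
pose W1 : porderType d :=
  HB.pack W (Order.Le_isPOrder.Build d W le_refl le_anti le_trans).
pose meet (x y : W1) : W1 := mk (val x :&: val y).
pose join (x y : W1) : W1 := mk (val x :|: val y).
have joinE x y : val (join x y) = val x :|: val y by rewrite mkP // rhoU !Wp.
have meetP (x y z : W1) : (x <= meet y z)%O = (x <= y)%O && (x <= z)%O.
  rewrite -[LHS]/(val x \subset rho _) -[RHS]/(le _ _ && le _ _) /le -finset.subsetI.
  apply/idP/idP => [|/rhoS]; last by rewrite Wp.
  move=> /fintype.subset_trans; apply; rewrite finset.subsetI; apply/andP.
  by split; apply: rhoW; rewrite ?finset.subsetIl ?finset.subsetIr.
have joinP (x y z : W1) : (join x y <= z)%O = (x <= z)%O && (y <= z)%O.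
  by rewrite -[LHS]/(le (join x y) z) /le joinE finset.subUset.
pose W2 : latticeType d :=
  HB.pack W W1 (Order.POrder_MeetJoin_isLattice.Build d W1 meetP joinP).
have meetUl : @left_distributive W2 W2 Order.meet Order.join.
  move=> x y z; apply: val_inj.
  rewrite -[LHS]/(rho _) -[RHS]/(val (join (meet x z) (meet y z))) joinE.
  by rewrite -[val _]/(val (join x y)) joinE finset.setIUl rhoU.
have le0 (x : W2) : ((mk finset.set0 : W2) <= x)%O.
  suff: le (mk finset.set0) x by [].
  by rewrite /le mkP ?rho0 // finset.sub0set.
have le1 (x : W2) : (x <= (mk [set: I]%SET : W2))%O.
  suff: le x (mk [set: I]%SET) by [].
  by rewrite /le -(Wp x); apply: rhoS; rewrite finset.subsetT.
pose L : finTBDistrLatticeType d := HB.pack W W2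
  (Order.Lattice_Meet_isDistrLattice.Build d W2 meetUl)
  (Order.hasBottom.Build d W2 le0) (Order.hasTop.Build d W2 le1).
exists d, L, val; split.
- exact: val_inj.
- by move=> A; split=> [/mkP <-|[x <-]]; [exists (mk A)|exact: Wp].
- exact: rho0.
- exact: joinE.
Qed.

End RetractLattice.

Section BooleanCornerEnd.
Import Order.Syntax.
Variables (S : pzSemiRingType) (e : S) (n : nat) (u v : 'I_n -> S).
Hypothesis bc : boolean_corner e u v.

Let e0 : e <> 0. Proof. by case: bc. Qed.
Let ese s : e * s * e = 0 \/ e * s * e = e. Proof. by case: bc. Qed.
Let full : 1 = \sum_i u i * e * v i. Proof. by case: bc. Qed.
Let ee : e * e = e. Proof. exact: boolean_corner_idem bc. Qed.
Let idem (x : S) : x + x = x. Proof. exact: (boolean_corner_addxx bc (x : S^o)). Qed.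

Let zsf (x y : S) : (x + y == 0) = (x == 0) && (y == 0).
Proof.
apply/eqP/andP => [xy|[/eqP -> /eqP ->]]; last exact: addr0.
have x0 : x = 0 by rewrite -[x]addr0 -xy addrA idem.
by move: xy; rewrite x0 add0r => ->; rewrite eqxx.
Qed.

(** The coordinates of [x * e] are [0] or [e]: [chi] codes this element by its support and [tau]
    decodes it, making [S e] a join retract of a power set. *)
Let chi (x : S) : {set 'I_n} := [set i | e * v i * x * e != 0].
Let tau (A : {set 'I_n}) : S := \sum_(i in A) u i * e.

Lemma corner_support_sum x : tau (chi x) = x * e.
Proof.
rewrite -[in RHS](mul1r x) full !mulr_suml /tau big_mkcond; apply: eq_bigr => i _.
rewrite inE; have := ese (v i * x); rewrite !mulrA => Ei.
have -> : u i * e * v i * x * e = u i * (e * v i * x * e) by rewrite !mulrA.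
by case: Ei => ->; rewrite ?eqxx ?mulr0 //=; case: eqP.
Qed.

Let chiD x y : chi (x + y) = chi x :|: chi y.
Proof.
by apply/setP => i; rewrite !inE mulrDr mulrDl zsf negb_and.
Qed.

Let chi0 : chi 0 = finset.set0.
Proof. by apply/setP => i; rewrite !inE mulr0 mul0r eqxx. Qed.

Let chie x : chi (x * e) = chi x.
Proof. by apply/setP => i; rewrite !inE -!mulrA ee. Qed.

Let taue A : tau A * e = tau A.
Proof. by rewrite /tau mulr_suml; apply: eq_bigr => i _; rewrite -mulrA ee. Qed.

Let tauU A B : tau (A :|: B) = tau A + tau B.
Proof.
rewrite /tau [LHS]big_mkcond [X in X + _]big_mkcond [X in _ + X]big_mkcond.
rewrite -big_split; apply: eq_bigr => i _ /=; rewrite inE.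
by case: (i \in A) (i \in B) => [] []; rewrite /= ?idem ?addr0 ?add0r.
Qed.

Lemma boolean_corner_End :
  exists (d : Order.disp_t) (L : finTBDistrLatticeType d),
    (exists x : L, x <> \bot%O) /\ semiring_isomorphic S (End L).
Proof.
have tau0 : tau finset.set0 = 0 by rewrite /tau big_set0.
have chiK x : chi (tau (chi x)) = chi x by rewrite corner_support_sum chie.
have [||A|d [L [i [iI iP i0 iU]]]] := @join_retract_lattice _ (chi \o tau).
- by rewrite /= tau0 chi0.
- by move=> A B; rewrite /= tauU chiD.
- exact: chiK.
have /choice[k kE] x : exists y : L, i y = chi x by apply/iP/chiK.
have ti x : chi (tau (i x)) = i x by apply/iP; exists x.
have kD x y : k (x + y) = (k x `|` k y)%O by apply: iI; rewrite iU !kE chiD.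
have k0 : k 0 = \bot%O by apply: iI; rewrite i0 kE chi0.
have ik x : k (tau (i x)) = x by apply: iI; rewrite kE ti.
have tk x : tau (i (k x)) = x * e by rewrite kE corner_support_sum.
have ke x : k (x * e) = k x by apply: iI; rewrite !kE chie.
have tiU x y : tau (i (x `|` y)%O) = tau (i x) + tau (i y) by rewrite iU tauU.
have act_endo s : join_endo [ffun x => k (s * tau (i x))].
  apply/join_endoP; rewrite !ffunE i0 tau0 mulr0; split=> // x y.
  by rewrite !ffunE tiU mulrDr kD.
pose f s : End L := MkEnd (act_endo s).
have fE s x : f s x = k (s * tau (i x)) by rewrite ffunE.
have fn : nmod_morphism f.
  split=> [|s t]; apply: End_eq => x; rewrite ffunE.
    by rewrite mul0r k0 ffunE.
  by rewrite mulrDl kD !ffunE.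
have fm : monoid_morphism f.
  split=> [|s t]; apply: End_eq => x; first by rewrite !ffunE mul1r ik.
  by rewrite End_mulE !fE tk -(mulrA t) taue mulrA.
pose fr : {rmorphism S -> End L} := HB.pack f
  (GRing.isNmodMorphism.Build S (End L) f fn)
  (GRing.isMonoidMorphism.Build S (End L) f fm).
exists d, L; split.
  exists (k 1) => k1; apply: e0; rewrite -[e]mul1r -tk k1 i0; exact: tau0.
(* [k (u j)] codes [u j * e], and an element [s] acting as [p] must satisfy
   [s = \sum_j (s * u j * e) * v j]. *)
pose g (p : End L) := \sum_j tau (i (p (k (u j)))) * v j.
exists fr; exists g => [s|p].
  rewrite /g -[s in RHS]mulr1 full mulr_sumr; apply: eq_bigr => j _.
  by rewrite /= fE !tk -(mulrA s _ e) -(mulrA (u j) e e) ee !mulrA.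
apply: End_eq => x; rewrite /= fE.
have [p0 pU] := EndP p.
have kp (F G : 'I_n -> S) : (forall j, k (F j) = p (k (G j))) ->
    k (\sum_j F j) = p (k (\sum_j G j)).
  move=> FG; elim/big_rec2: _ => [|j y z _ IH]; first by rewrite k0 p0.
  by rewrite !kD pU -IH FG.
pose y := tau (i x); pose c j := e * v j * y * e.
have -> : g p * y = \sum_j tau (i (p (k (u j)))) * c j.
  rewrite /g mulr_suml; apply: eq_bigr => j _.
  by rewrite -{1}(taue (i (p _))) /c /y -!mulrA taue.
rewrite (kp _ (fun j => u j * c j)) => [|j].
  rewrite -[in RHS](ik x) -(taue (i x)) -/y -[X in _ = p (k (X * e))]mul1r full.
  rewrite !mulr_suml.
  by congr (p (k _)); apply: eq_bigr => j _; rewrite /c !mulrA.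
(* The coordinates being [0] or [e], preservation of joins and bottom is all that is asked of
   [p]. *)
have : c j = 0 \/ c j = e by rewrite /c -(mulrA e); apply: ese.
by case=> ->; [rewrite !mulr0 k0 p0 | rewrite !ke ik].
Qed.
End BooleanCornerEnd.

(** * Complements and injectivity over a ring with a division corner *)

Section Submodules.
Variables (R : pzRingType).

Lemma lSemiMod_lmod (M : lSemiModType R) :
  exists M' : lmodType R, M = M' :> lSemiModType R.
Proof.
have addNr : left_inverse 0 (fun x : M => (-1 : R) *: x) +%R.
  by move=> x; rewrite -{2}[x]scale1r -scalerDl addNr scale0r.
pose M' : lmodType R := HB.pack (GRing.LSemiModule.sort M)
  (GRing.Nmodule_isZmodule.Build M addNr).
by exists M'; rewrite {}/M'; case: M addNr.
Qed.

Variable B : lmodType R.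

Definition submodule (A : B -> Prop) :=
  [/\ A 0, forall x y, A x -> A y -> A (x + y) & forall (s : R) x, A x -> A (s *: x)].

Lemma submodule_opp A x : submodule A -> A x -> A (- x).
Proof. by case=> _ _ AZ Ax; rewrite -scaleN1r; apply: AZ. Qed.

(** Zorn: the last clause is what maximality of [Z] gives for [R b + Z], and says that [A + Z] is
    essential. *)
Lemma maximal_disjoint (A : B -> Prop) : submodule A ->
  exists Z, [/\ submodule Z, forall x, A x -> Z x -> x = 0 &
    forall b, ~ Z b -> exists s z, [/\ Z z, A (s *: b + z) & s *: b + z <> 0]].
Proof.
move=> [A0 AD AZ].
(* [0] is not required in [Z], so that the empty chain has an upper bound *)
pose P (Z : set B) := [/\ forall x y, Z x -> Z y -> Z (x + y),
  forall (s : R) x, Z x -> Z (s *: x) & forall x, A x -> Z x -> x = 0].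
have [F FP Ftot|Z [[ZD ZZ ZA] Zmax]] := @Zorn_bigcup B P.
  split=> [x y [X FX Xx] [Y FY Yy]|s x [X FX Xx]|x Ax [X FX Xx]].
  - have [XY|YX] := Ftot _ _ FX FY; have [XD _ _] := FP _ FX; have [YD _ _] := FP _ FY.
      by exists Y => //; apply: YD => //; apply: XY.
    by exists X => //; apply: XD => //; apply: YX.
  - by have [_ XZ _] := FP _ FX; exists X => //; apply: XZ.
  - by have [_ _ XA] := FP _ FX; apply: XA.
have Zext b (Z' := [set x | exists s z, (Z z \/ z = 0) /\ x = s *: b + z]%classic) :
    ~ Z b -> exists2 x, A x & Z' x /\ x <> 0.
  move=> nZb; apply: contrapT => nx; apply: (Zmax Z').
    split=> [|ZZ'].
  - by move=> x Zx; exists 0, x; rewrite scale0r add0r; split=> //; left.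
  - by apply: nZb; apply: ZZ'; exists 1, 0; rewrite scale1r addr0; split=> //; right.
  split=> [x y [s [z [Zz ->]]] [t [z' [Zz' ->]]]|t x [s [z [Zz ->]]]|x Ax Z'x].
  - exists (s + t), (z + z'); rewrite addrACA scalerDl; split=> //.
    case: Zz Zz' => [Zz|->] [Zz'|->]; rewrite ?add0r ?addr0; [left|left|left|right] => //.
    exact: ZD.
  - exists (t * s), (t *: z); rewrite scalerDr scalerA; split=> //.
    by case: Zz => [Zz|->]; [left; apply: ZZ|right; rewrite scaler0].
  - by apply: contrapT => x0; apply: nx; exists x.
have Z0 : Z 0.
  apply: contrapT => /Zext[x Ax [[s [z [Zz xE]]]]]; apply.
  rewrite xE scaler0 add0r in Ax *; case: Zz => // Zz; exact: ZA.
exists Z; split=> // b /Zext[x Ax [[s [z [Zz xE]]] x0]].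
by exists s, z; rewrite -xE; split=> //; case: Zz => [//|->].
Qed.

End Submodules.

(* [e * t * e] is then a left inverse of [e * s * e] in [e S e]. *)
Definition division_corner (S : pzSemiRingType) (e : S) (n : nat) (u v : 'I_n -> S) :=
  [/\ e <> 0, e * e = e, forall s, e * s * e <> 0 -> exists t, t * (e * s * e) = e
    & 1 = \sum_i u i * e * v i].

Section DivisionCorner.
Variables (R : pzRingType) (e : R) (n : nat) (u v : 'I_n -> R).
Hypothesis dc : division_corner e u v.

Let e0 : e <> 0. Proof. by case: dc. Qed.
Let ee : e * e = e. Proof. by case: dc. Qed.
Let ediv s : e * s * e <> 0 -> exists t, t * (e * s * e) = e.
Proof. by case: dc => _ _ + _; apply. Qed.
Let full : 1 = \sum_i u i * e * v i. Proof. by case: dc. Qed.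

Lemma division_corner_simple : simple R.
Proof.
apply: corner_simple full e0 ediv _ => r [rr _ _ rD rM] s t rst st.
have [|c cE] := @ediv (s - t).
  by rewrite mulrBr mulrBl => /eqP; rewrite subr_eq0 => /eqP.
rewrite -[X in r X]cE -(mulr0 c) mulrBr mulrBl; apply: rM => //.
by rewrite -[X in r _ X](subrr (e * t * e)); apply: rD.
Qed.

(** If [e *: b = b], each nonzero multiple of [b] generates [R b]. As [A + Z] is essential, it
    contains such a multiple and thus [b]; by [corner_decomp] these [b] generate the whole
    module. *)
Lemma division_corner_complement (B : lmodType R) (A : B -> Prop) : submodule A ->
  exists Z, [/\ submodule Z, forall x, A x -> Z x -> x = 0 &
    forall b, exists a z, [/\ A a, Z z & b = a + z]].
Proof.
move=> Asub; have [A0 AD AZ] := Asub.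
have [Z [Zsub ZA Zmax]] := maximal_disjoint Asub; have [Z0 ZD ZZ] := Zsub.
exists Z; split=> // b0; pose AZ_sum b := exists a z, [/\ A a, Z z & b = a + z].
have sum0 : AZ_sum 0 by exists 0, 0; rewrite addr0.
have sumD x y : AZ_sum x -> AZ_sum y -> AZ_sum (x + y).
  move=> [a [z [Aa Zz ->]]] [a' [z' [Aa' Zz' ->]]]; exists (a + a'), (z + z').
  by rewrite addrACA; split; [exact: AD|exact: ZD|].
have sumZ s x : AZ_sum x -> AZ_sum (s *: x).
  move=> [a [z [Aa Zz ->]]]; exists (s *: a), (s *: z).
  by rewrite scalerDr; split; [exact: AZ|exact: ZZ|].
rewrite -/(AZ_sum b0) (corner_decomp full b0).
elim/big_ind: _ => // i _; apply: (sumZ); set b := e *: _; apply: contrapT => nb.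
have eb : e *: b = b by rewrite scalerA ee.
have [|s [z [Zz As sz0]]] := Zmax b.
  by move=> Zb; apply: nb; exists 0, b; rewrite add0r.
have sb0 : s *: b <> 0.
  by move=> sb; apply: sz0; rewrite sb add0r in As *; apply: ZA.
have [j cj] : exists j, e * (v j * s) * e <> 0.
  apply: contrapT => nj; apply: sb0; rewrite (corner_decomp full (s *: b)) big1 // => j _.
  have -> : e *: (v j *: (s *: b)) = (e * (v j * s) * e) *: b.
    by rewrite -[in LHS]eb !scalerA !mulrA.
  suff -> : e * (v j * s) * e = 0 by rewrite scale0r scaler0.
  by apply: contrapT => cj; apply: nj; exists j.
have [t tE] := ediv cj; apply: nb.
have -> : b = (t * e * v j) *: (s *: b).
  by rewrite scalerA -[in RHS]eb -[LHS]eb -[X in X *: _ = _]tE scalerA !mulrA.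
apply: sumZ; exists (s *: b + z), (- z); rewrite addrK; split=> //.
exact: submodule_opp.
Qed.

Lemma division_corner_e_injective (M : lSemiModType R) : e_injective M.
Proof.
have [M' ->] := lSemiMod_lmod M; apply: e_injective_intro => A B.
have [B' ->] := lSemiMod_lmod B => f fI _.
have [|Z [[Z0 ZD ZZ] Zf fZ]] :=
  @division_corner_complement B' (fun b => exists a, f a = b).
  split=> [|_ _ [a <-] [a' <-]|s _ [a <-]]; first by exists 0; rewrite linear0.
    by exists (a + a'); rewrite linearD.
  by exists (s *: a); rewrite linearZ.
have [b|b a a' Za Za'|x y a a' Za Za'|s x a Za|p pE] :=
  @linear_of_graph R B' A (fun b a => Z (b - f a)).
- by have [_ [z [[a <-] Zz ->]]] := fZ b; exists a; rewrite addrC addKr.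
- apply/fI/eqP; rewrite -subr_eq0; apply/eqP/Zf.
    by exists (a + (-1 : R) *: a'); rewrite linearD linearZ /= scaleN1r.
  have -> : f a - f a' = (b - f a') - (b - f a) by rewrite opprB [RHS]addrC addrA subrK.
  by apply: ZD => //; rewrite -scaleN1r; apply: ZZ.
- by rewrite linearD opprD addrACA; apply: ZD.
- by rewrite linearZ /= -scalerBr; apply: ZZ.
have pf a : p (f a) = a.
  apply/esym/fI/eqP; rewrite -subr_eq0; apply/eqP/Zf; last exact: pE.
  by exists (a + (-1 : R) *: p (f a)); rewrite linearD linearZ /= scaleN1r.
split=> [h|h h' hh']; first by exists (h \o p) => a /=; rewrite pf.
(* The corrections are the parts of [h'] and [h] living on the complement [Z]; what remains is the
   common restriction, extended by [p]. *)
exists (h' \- (h' \o f \o p)), (h \- (h \o f \o p)).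
split=> [a|a|b] /=; rewrite ?pf ?subrr //.
by rewrite hh' addrCA addrA addrC.
Qed.

End DivisionCorner.

(** * Division corners and matrix rings *)

Lemma matrix_division_corner (D : nzRingType) (n : nat) :
  division_ring D -> (0 < n)%N ->
  exists e m (u v : 'I_m -> 'M[D]_n), division_corner e u v.
Proof.
case: n => // n Ddiv _; pose e : 'M[D]_n.+1 := delta_mx 0 0.
have eM (A : 'M[D]_n.+1) : e * A * e = A 0 0 *: e.
  apply/matrixP => i j; rewrite !mxE (bigD1 0) //= big1 => [|k k0]; last first.
    by rewrite [X in _ * X]mxE (negbTE k0) mulr0.
  rewrite !mxE (bigD1 0) //= big1 => [|k k0]; last first.
    by rewrite !mxE (negbTE k0) andbF mul0r.
  by rewrite !mxE !addr0 andbT; case: (i == 0); rewrite ?mul1r // !mul0r mulr0.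
exists e, n.+1, (fun i => delta_mx i 0), (fun i => delta_mx 0 i); split.
- by move=> /matrixP/(_ 0 0)/eqP; rewrite !mxE oner_eq0.
- exact: mul_delta_mx.
- move=> A; rewrite eM => A0; have [|y [_ yA]] := Ddiv (A 0 0).
    by apply: contra_notN A0 => /eqP ->; rewrite scale0r.
  exists (y%:M); rewrite [_ * _]mul_scalar_mx scalerA yA scale1r //.
rewrite -[LHS]/(1%:M) mx1_sum_delta; apply: eq_bigr => i _.
by rewrite -[RHS]/(_ *m _ *m _) !mul_delta_mx.
Qed.

Lemma division_corner_transport (S T : pzSemiRingType) :
  semiring_isomorphic S T ->
  (exists e n (u v : 'I_n -> S), division_corner e u v) ->
  exists e n (u v : 'I_n -> T), division_corner e u v.
Proof.
case=> f [g fK gK] [e [n [u [v [e0 ee ediv full]]]]].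
exists (f e), n, (f \o u), (f \o v); split.
- by move=> fe; apply: e0; apply: (can_inj fK); rewrite fe rmorph0.
- by rewrite -rmorphM ee.
- move=> s; rewrite -(gK s) -!rmorphM => ne.
  have [|t tE] := ediv (g s); first by move=> E; apply: ne; rewrite E rmorph0.
  by exists (f t); rewrite -rmorphM tE.
- by rewrite -(rmorph1 f) full rmorph_sum; apply: eq_bigr => i _; rewrite !rmorphM.
Qed.

Lemma corner_ring (R : pzRingType) (e : R) : e * e = e -> e <> 0 ->
  exists (D : nzRingType) (i : D -> R),
    [/\ injective i, forall x, e * x * e = x <-> exists d, i d = x,
        {morph i : x y / x + y}, {morph i : x y / x * y} & i 1 = e].
Proof.
move=> ee e0; pose W := {x : R | e * x * e == x}.
have mkP x : e * (e * x * e) * e == e * x * e by rewrite !mulrA ee -!mulrA ee.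
pose mk x : W := exist _ (e * x * e) (mkP x).
have We (x : W) : e * val x * e = val x by apply/eqP/(valP x).
have eW (x : W) : e * val x = val x by rewrite -(We x) !mulrA ee.
have We' (x : W) : val x * e = val x by rewrite -(We x) -!mulrA ee.
pose add (x y : W) := mk (val x + val y); pose opp (x : W) := mk (- val x).
pose mul (x y : W) := mk (val x * val y).
have addE x y : val (add x y) = val x + val y by rewrite /= mulrDr mulrDl !We.
have oppE x : val (opp x) = - val x by rewrite /= mulrN mulNr We.
have mulE x y : val (mul x y) = val x * val y by rewrite /= mulrA eW -mulrA We'.
have zeroE : val (mk 0) = 0 by rewrite /= mulr0 mul0r.
have oneE : val (mk 1) = e by rewrite /= mulr1 ee.
have addA : associative add by move=> x y z; apply: val_inj; rewrite !addE addrA.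
have addC : commutative add by move=> x y; apply: val_inj; rewrite !addE addrC.
have add0 : left_id (mk 0) add by move=> x; apply: val_inj; rewrite addE zeroE add0r.
have addN : left_inverse (mk 0) opp add.
  by move=> x; apply: val_inj; rewrite addE oppE zeroE addNr.
have mulA : associative mul by move=> x y z; apply: val_inj; rewrite !mulE mulrA.
have mul1 : left_id (mk 1) mul by move=> x; apply: val_inj; rewrite mulE oneE eW.
have mulr1 : right_id (mk 1) mul by move=> x; apply: val_inj; rewrite mulE oneE We'.
have mulDl : left_distributive mul add.
  by move=> x y z; apply: val_inj; rewrite !(mulE, addE) mulrDl.
have mulDr : right_distributive mul add.
  by move=> x y z; apply: val_inj; rewrite !(mulE, addE) mulrDr.
have one0 : mk 1 != mk 0.
  by apply/eqP => /(congr1 val); rewrite oneE zeroE.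
pose Z : zmodType := HB.pack W (GRing.isZmodule.Build W addA addC add0 addN).
pose D : nzRingType := HB.pack W Z
  (GRing.Zmodule_isNzRing.Build Z mulA mul1 mulr1 mulDl mulDr one0).
exists D, val; split=> //; first exact: val_inj.
move=> x; split=> [xE|[d <-]]; last exact: We.
by exists (mk x : D); rewrite /= xE.
Qed.

Section DivisionCornerMatrix.
Variable R : pzRingType.

(** In a shortest presentation of [1], the [e * v k] form a basis of [e R] over [e R e]: a relation
    with a nonzero coefficient could be solved for some [e * v j0], and substituting would shorten
    the presentation. *)
Lemma division_corner_basis (e : R) n (u v : 'I_n -> R) : division_corner e u v ->
  exists m (u' v' : 'I_m -> R), division_corner e u' v' /\
    forall i j, e * v' i * u' j * e = if i == j then e else 0.
Proof.
move=> dc; pose P m := `[< exists u' v' : 'I_m -> R, division_corner e u' v' >].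
have exP : exists m, P m by exists n; apply/asboolP; exists u, v.
case: (ex_minnP exP) => m /asboolP[{n dc}u [{}v dc]] mmin.
exists m, u, v; split=> // i0 j0; have [e0 ee ediv full] := dc.
(* The trivial expansion of [e * v i0] along the [e * v k], minus the one obtained from
   [e * v i0 * 1]. *)
pose w k := (if i0 == k then e else 0) - e * v i0 * u k * e.
suff : w j0 = 0 by rewrite /w => /eqP; rewrite subr_eq0 => /eqP ->.
have ew k : e * w k = w k by rewrite /w mulrBr !mulrA; case: eqP; rewrite ?mulr0 ee.
have we k : w k * e = w k.
  by rewrite /w mulrBl -(mulrA _ e e) ee; case: eqP; rewrite ?mul0r ?ee.
have sum_w : \sum_k w k * v k = 0.
  rewrite (eq_bigr
    (fun k => (if k == i0 then e * v i0 else 0) - e * v i0 * (u k * e * v k))).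
    rewrite sumrB -mulr_sumr -full mulr1 -big_mkcond big_pred1_eq subrr //.
  move=> k _; rewrite /w mulrBl eq_sym !mulrA; congr (_ - _).
  by case: eqP => [->|_] //; rewrite mul0r.
clearbody w; apply: contrapT => wj; have [|t] := ediv (w j0); rewrite ew we // => tE.
pose A := predC1 j0; pose u2 k := u k - u j0 * t * w k.
have full2 : 1 = \sum_(k in A) u2 k * e * v k.
  have evj : e * v j0 = - \sum_(k in A) t * (w k * v k).
    move: sum_w; rewrite (bigD1 j0) //= => /(congr1 (fun x => t * x)).
    rewrite mulr0 mulrDr mulrA tE mulr_sumr => /eqP; rewrite addr_eq0 => /eqP ->.
    by congr (- _); apply: eq_bigl => k; rewrite inE.
  rewrite full (bigD1 j0) //= addrC -mulrA evj mulrN mulr_sumr -sumrN.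
  rewrite (eq_bigl (fun k => k \in A)) => [|k]; last by rewrite inE.
  rewrite -big_split; apply: eq_bigr => k _ /=.
  by rewrite /u2 !mulrBl -(mulrA _ (w k) e) we !mulrA.
have : (m <= #|A|)%N.
  apply: mmin; apply/asboolP.
  exists (fun i => u2 (enum_val i)), (fun i => v (enum_val i)); split=> //.
  by rewrite full2 (big_enum_val (A := A) (fun k => u2 k * e * v k)).
by rewrite cardC1 card_ord leqNgt prednK ?leqnn // (leq_ltn_trans (leq0n j0)) //.
Qed.

(** [f] lists the entries of [s]. It is multiplicative because [1 = \sum_i u i * e * v i]; duality
    of [u] and [v] makes it unital and onto. *)
Lemma division_corner_matrix (e : R) n (u v : 'I_n -> R) : division_corner e u v ->
  exists (D : nzRingType) (m : nat),
    division_ring D /\ (0 < m)%N /\ semiring_isomorphic R 'M[D]_m.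
Proof.
case/division_corner_basis => {n u v} m [u [v [[e0 ee ediv full] dual]]].
have [D [i [iI iP iD iM i1]]] := corner_ring ee e0.
have i0 : i 0 = 0 by apply: (addIr (i 0)); rewrite -iD !add0r.
have ie d : e * i d * e = i d by apply/iP; exists d.
have ei d : e * i d = i d by rewrite -(ie d) !mulrA ee.
have ie' d : i d * e = i d by rewrite -(ie d) -!mulrA ee.
have isum (I : finType) (F : I -> D) : i (\sum_j F j) = \sum_j i (F j).
  by elim/big_rec2: _ => // j x y _ <-; rewrite iD.
have /choice[k kE] x : exists d, i d = e * x * e.
  by apply/iP; rewrite !mulrA ee -!mulrA ee.
have linv (x : D) : x != 0 -> exists y, y * x = 1.
  move=> /eqP x0; have [|t tE] := ediv (i x).
    by rewrite ie => E; apply: x0; apply: iI; rewrite E.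
  by rewrite ie in tE; exists (k t); apply: iI; rewrite iM i1 kE -!mulrA ei tE ee.
exists D, m; split.
  move=> x x0; have [y yx] := linv x x0; exists y; split=> //.
  have [|z zy] := linv y; last by rewrite -[x]mul1r -zy -(mulrA z) yx mulr1.
  by apply/eqP => y0; move/eqP: yx; rewrite y0 mul0r eq_sym oner_eq0.
split.
  case: m u v full dual => // u v; rewrite big_ord0 => R0.
  by case: e0; rewrite -[e]mulr1 R0 mulr0.
pose f (s : R) : 'M[D]_m := \matrix_(a, b) k (v a * s * u b).
have fE s a b : i (f s a b) = e * v a * s * u b * e by rewrite mxE kE !mulrA.
have fn : nmod_morphism f.
  split=> [|s t]; apply/matrixP => a b; apply: iI.
    by rewrite fE mxE i0 mulr0 !mul0r.
  by rewrite [in RHS]mxE iD !fE mulrDr !mulrDl.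
have fm : monoid_morphism f.
  split=> [|s t]; apply/matrixP => a b; apply: iI.
    by rewrite fE mulr1 dual mxE; case: eqP; rewrite ?i0 ?i1.
  rewrite [in RHS]mxE isum fE.
  rewrite -[in LHS](mulr1 s) full !(mulr_sumr, mulr_suml); apply: eq_bigr => c _.
  by rewrite iM !fE !mulrA -(mulrA _ e e) ee.
pose fr : {rmorphism R -> 'M[D]_m} := HB.pack f
  (GRing.isNmodMorphism.Build R 'M[D]_m f fn)
  (GRing.isMonoidMorphism.Build R 'M[D]_m f fm).
pose g (M : 'M[D]_m) := \sum_a \sum_b u a * i (M a b) * v b.
exists fr; exists g => [s|M].
  apply: (corner_eq full) => a b; rewrite /g.
  transitivity
    (\sum_c \sum_d (e * v a * u c * e) * (v c * s * u d) * (e * v d * u b * e)).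
    rewrite mulr_sumr !mulr_suml; apply: eq_bigr => c _.
    rewrite mulr_sumr !mulr_suml; apply: eq_bigr => d _.
    by rewrite fE !mulrA.
  rewrite (bigD1 a) //= [X in _ + X]big1 ?addr0 => [|c ca]; last first.
    by apply: big1 => d _; rewrite dual eq_sym (negbTE ca) !mul0r.
  rewrite (bigD1 b) //= [X in _ + X]big1 ?addr0 => [|d db]; last first.
    by rewrite (dual d b) (negbTE db) mulr0.
  by rewrite !dual !eqxx !mulrA.
apply/matrixP => a b; apply: iI; rewrite fE /g.
transitivity (\sum_c \sum_d (e * v a * u c * e) * i (M c d) * (e * v d * u b * e)).
  rewrite mulr_sumr !mulr_suml; apply: eq_bigr => c _.
  rewrite mulr_sumr !mulr_suml; apply: eq_bigr => d _.
  by rewrite -[in LHS](ie (M c d)) !mulrA.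
rewrite (bigD1 a) //= [X in _ + X]big1 ?addr0 => [|c ca]; last first.
  by apply: big1 => d _; rewrite dual eq_sym (negbTE ca) !mul0r.
rewrite (bigD1 b) //= [X in _ + X]big1 ?addr0 => [|d db]; last first.
  by rewrite (dual d b) (negbTE db) mulr0.
by rewrite !dual !eqxx ie.
Qed.

End DivisionCornerMatrix.

(** * Rings with injective cyclic modules *)

Section CyclicInjective.
Variable R : pzRingType.

Lemma ring_subtractive (A B : lSemiModType R) (f : {linear A -> B}) a a' b :
  f a + b = f a' -> exists a'', f a'' = b.
Proof.
move=> E; exists (a' + (-1 : R) *: a); rewrite linearD linearZ /= -E addrAC.
by rewrite -{1}[f a]scale1r -scalerDl subrr scale0r add0r.
Qed.

(** [G] is the graph of a homomorphism on a left ideal; [m0] is the value at [1] of an extension to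
    [R]. *)
Lemma Baer (M : lSemiModType R) (G : R -> M -> Prop) :
  e_injective M -> (exists m, G 0 m) ->
  (forall x m m', G x m -> G x m' -> m = m') ->
  (forall x y m n, G x m -> G y n -> G (x + y) (m + n)) ->
  (forall s x m, G x m -> G (s * x) (s *: m)) ->
  exists m0, forall x m, G x m -> m = x *: m0.
Proof.
move=> Minj G0 Gf GD GZ.
have [//|x y [m Gm] [n Gn]|s x [m Gm]|A [i [iI iP]]] :=
  @subsemimodule_exists R R^o (fun x => exists m, G x m).
- by exists (m + n); apply: GD.
- by exists (s *: m); apply: GZ.
have [a|a|a b m n|s a m|h hP] := @linear_of_graph R A M (fun a m => G (i a) m).
- by apply/iP; exists a.
- exact: Gf.
- by rewrite linearD; apply: GD.
- by rewrite linearZ; apply: GZ.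
have [|k kP] := e_injective_extend h Minj iI; first exact: ring_subtractive.
exists (k (1 : R)) => x m Gm; have /iP[a ax] : exists m, G x m by exists m.
rewrite -linearZ /= -[x *: _]/(x * 1) mulr1 -ax kP.
by apply: Gf Gm _; rewrite -ax.
Qed.

Hypothesis cyc : forall M : lSemiModType R, cyclic M -> e_injective M.

(** The cyclic left ideal [R a] is injective, hence a retract of [R]; the retraction sends [1] to
    some [r * a] and fixes [a]. *)
Lemma cyclic_injective_regular (a : R) : exists r, a = a * r * a.
Proof.
have [||s x [t ->]|A [i [iI iP]]] :=
  @subsemimodule_exists R R^o (fun x => exists s : R, x = s * a).
- by exists 0; rewrite mul0r.
- by move=> _ _ [s ->] [t ->]; exists (s + t); rewrite mulrDl.
- by exists (s * t); rewrite -[LHS]/(s * (t * a)) mulrA.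
have [a0 a0E] : exists a0, i a0 = a by apply/iP; exists 1; rewrite mul1r.
have [p pE] := linear_orbit a0.
have Ainj : e_injective A.
  apply: cyc; exists p => m; have /iP[s sE] : exists m', i m' = i m by exists m.
  by exists s; apply: iI; rewrite pE linearZ /= a0E sE.
have [|k kP] := @e_injective_extend R A A R^o i idfun Ainj iI.
  exact: ring_subtractive.
have /iP[r rE] : exists m', i m' = i (k (1 : R)) by exists (k (1 : R)).
have ik : a * (i (k (1 : R)) : R) = i (k (a : R)).
  by rewrite -[in RHS](mulr1 a) -[a * 1]/(a *: (1 : R^o)) !linearZ.
by exists r; rewrite -mulrA -rE ik -{2}a0E kP.
Qed.

Section Osofsky.

Hypothesis one_neq0 : 1 <> 0 :> R.
Hypothesis no_division_corner : forall e : R, e * e = e -> e <> 0 ->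
  exists s, e * s * e <> 0 /\ forall t, t * (e * s * e) <> e.

(** Let [a = e * s * e] be nonzero without left inverse to [e]. With [a = a * r * a], the idempotent
    is [e * r * a]; were it [e], then [e * r] would be such an inverse. *)
Lemma smaller_idempotent (e : R) : e * e = e /\ e <> 0 -> exists f,
  [/\ f * f = f, f <> 0, e * f = f, f * e = f & f <> e].
Proof.
move=> [ee e0]; have [s [a0 na]] := no_division_corner ee e0.
set a := e * s * e in a0 na; have [r ar] := cyclic_injective_regular a.
have ae : a * e = a by rewrite /a -!mulrA ee.
clearbody a.
exists (e * r * a); split.
- by rewrite -!mulrA (mulrA a e) ae (mulrA a r) -ar.
- by move=> E; apply: a0; rewrite ar -{1}ae -!mulrA (mulrA e) E mulr0.
- by rewrite !mulrA ee.
- by rewrite -mulrA ae.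
- exact: na.
Qed.

Lemma decreasing_idempotents : exists h : nat -> R,
  [/\ h 0%N = 1, forall m n, (m <= n)%N -> h m * h n = h n,
      forall m n, (m <= n)%N -> h n * h m = h n & forall n, h n <> h n.+1].
Proof.
have /choice[next nextP] (e : R) : exists f, e * e = e /\ e <> 0 ->
    [/\ f * f = f, f <> 0, e * f = f, f * e = f & f <> e].
  have [E|nE] := pselect (e * e = e /\ e <> 0); last by exists 0.
  by have [f fP] := smaller_idempotent E; exists f.
pose h n := iter n next (1 : R).
have hP n : h n * h n = h n /\ h n <> 0.
  elim: n => [|n IH]; first by rewrite mulr1.
  by have [] := nextP _ IH.
have hl m n : (m <= n)%N -> h m * h n = h n.
  move/subnK <-; elim: (n - m)%N => [|k IH]; first by have [] := hP m.
  have [_ _ E _ _] := nextP _ (hP (k + m)%N).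
  by rewrite addSn -[h _.+1]/(next (h (k + m)%N)) -{1}E mulrA IH E.
have hr m n : (m <= n)%N -> h n * h m = h n.
  move/subnK <-; elim: (n - m)%N => [|k IH]; first by have [] := hP m.
  have [_ _ _ E _] := nextP _ (hP (k + m)%N).
  by rewrite addSn -[h _.+1]/(next (h (k + m)%N)) -{1}E -mulrA IH E.
exists h; split=> // n.
by have [_ _ _ _ ne] := nextP _ (hP n); move=> E; apply: ne; rewrite -[LHS]/(h n.+1) -E.
Qed.

(* An infinite family of orthogonal idempotents extends to a copy of the
   Boolean algebra of all subsets of [nat]: [g A] is right multiplication
   extending the projection of [(+)_n R E_n (+) Z] onto the summands indexed by
   [A], where [Z] makes this sum essential. *)
Lemma subset_idempotents : exists g : (nat -> bool) -> R,
  [/\ forall A B C, (forall n, C n = A n && B n) -> g A * g B = g C,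
      forall A, (forall n, ~~ A n) -> g A = 0 & forall n, g (pred1 n) <> 0].
Proof.
have [h [h0 hl hr hne]] := decreasing_idempotents.
pose E n := h n - h n.+1.
have Eh n N : (n < N)%N -> E n * h N = 0.
  by move=> nN; rewrite mulrBl !hl ?subrr // ltnW.
have hE n N : (N <= n)%N -> h N * E n = E n.
  by move=> nN; rewrite mulrBr !hl // leqW.
have EE m n : E m * E n = if m == n then E n else 0.
  case: ltngtP => [mn|nm|->].
  - by rewrite -(hE n m.+1) // mulrA Eh ?mul0r.
  - by rewrite {2}/E mulrBr {1 2}/E !mulrBl !hr ?subrr // ltnW // leqW.
  - by rewrite {2}/E mulrBr (Eh n n.+1) // subr0 {1}/E mulrBl hl // hr.
have sumE N : \sum_(0 <= n < N) E n = 1 - h N.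
  rewrite -h0 (telescope_sumr_eq (fun n => - h n)) // => [|n _].
    by rewrite opprK addrC.
  by rewrite opprK addrC.
have xhN x m N : (m <= N)%N -> x * h m = 0 -> x * h N = 0.
  by move=> mN xm; rewrite -(hl m N) // mulrA xm mul0r.
(* By [sumE], [x * h N = 0] means that [x] is the sum of the [x * E n] with [n < N]: the submodule
   is the direct sum of the [R E_n]. *)
have [|Z [[Z0 ZD ZZ] ZI Zmax]] :=
  @maximal_disjoint R R^o (fun x => exists N, (x : R) * h N = 0).
  split=> [|x y [N xN] [N' yN]|s x [N xN]]; first by exists 0%N; rewrite mul0r.
    exists (maxn N N'); rewrite mulrDl (xhN _ _ _ (leq_maxl _ _) xN).
    by rewrite (xhN _ _ _ (leq_maxr _ _) yN) addr0.
  by exists N; rewrite -[s *: _]/(s * x) -mulrA xN mulr0.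
(* Nonsingularity: whatever kills [y] kills the idempotent [f = y * r]. By essentiality some nonzero
   [s * f] lies in the essential left ideal, so it kills [f], although [s * f * f = s * f]. *)
have ess y : (forall n, E n * y = 0) -> (forall z : R, Z z -> z * y = 0) -> y = 0.
  move=> Ey Zy; apply: contrapT => y0; have [r yr] := cyclic_injective_regular y.
  pose f := y * r; have ff : f * f = f by rewrite /f mulrA -yr.
  have f0 : f <> 0 by move=> f0; apply: y0; rewrite yr -/f f0 mul0r.
  have Zf z : Z z -> z * f = 0 by move=> Zz; rewrite mulrA Zy ?mul0r.
  have [|s [z [Zz [N If] sz0]]] := Zmax f.
    by move/Zf; rewrite ff.
  have sf : s * f = 0.
    have : (s * f + z) * f = 0.
      rewrite -[s * f + z]mulr1 -[1](subrK (h N)) mulrDr If addr0.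
      rewrite -sumE mulr_sumr mulr_suml big1 // => n _.
      by rewrite -mulrA /f (mulrA (E n)) Ey mul0r mulr0.
    by rewrite mulrDl (Zf z) // addr0 -mulrA ff.
  apply: sz0; rewrite -[_ *: _]/(s * f) sf add0r in If *.
  by apply: ZI => //; exists N.
have /choice[g gP] (A : nat -> bool) : exists x : R,
    (forall n, E n * x = if A n then E n else 0) /\ forall z : R, Z z -> z * x = 0.
  (* The sum is the projection of [x] onto the summands indexed by [A]; asking for all [N >= N0]
     allows two elements to be compared at a common bound. *)
  pose G (y m : R) := exists x z N0, [/\ y = x + z, Z z &
    forall N, (N0 <= N)%N -> x * h N = 0 /\ m = \sum_(0 <= n < N | A n) x * E n].
  have GE n : G (E n) (if A n then E n else 0).
    exists (E n), 0, n.+1; split=> // [|N nN]; first by rewrite addr0.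
    split; first exact: Eh.
    rewrite (eq_bigr (fun k => if n == k then E k else 0)) => [|k _]; last exact: EE.
    rewrite -big_mkcondr (eq_bigl (fun k => A n && (k == n))) => [|k]; last first.
      by rewrite eq_sym; case: eqP => [->|_]; rewrite ?andbT ?andbF.
    rewrite big_mkcondl; case: (A n); last by rewrite big1_eq.
    by rewrite big_nat1_eq nN.
  have GZ z : Z z -> G z 0.
    move=> Zz; exists 0, z, 0%N; rewrite add0r; split=> // N _.
    by rewrite mul0r big1 // => n _; rewrite mul0r.
  have Rinj : e_injective (R^o : lSemiModType R).
    by apply: cyc; exists idfun => m; exists m.
  have [|y m m'|y y' m m'|s y m|x xP] := @Baer R^o G Rinj.
  - by exists 0; apply: GZ.
  - move=> [x [z [N [-> Zz NP]]]] [x' [z' [N' [E' Zz' NP']]]].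
    have [xM ->] := NP _ (leq_maxl N N'); have [xM' ->] := NP' _ (leq_maxr N N').
    suff -> : x = x' by [].
    apply/eqP; rewrite -subr_eq0; apply/eqP/ZI.
      by exists (maxn N N'); rewrite mulrBl xM xM' subrr.
    have -> : x - x' = z' - z.
      by apply/eqP; rewrite subr_eq addrAC eq_sym subr_eq addrC -E' addrC.
    by apply: ZD => //; rewrite -mulN1r; apply: (ZZ (-1)).
  - move=> [x [z [N [-> Zz NP]]]] [x' [z' [N' [-> Zz' NP']]]].
    exists (x + x'), (z + z'), (maxn N N'); rewrite addrACA; split=> // [|M].
      exact: ZD.
    rewrite geq_max => /andP[NM NM']; have [xM ->] := NP _ NM; have [xM' ->] := NP' _ NM'.
    rewrite mulrDl xM xM' addr0 -big_split; split=> //.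
    by apply: eq_bigr => n _; rewrite mulrDl.
  - move=> [x [z [N [-> Zz NP]]]]; exists (s * x), (s * z), N.
    rewrite mulrDr; split=> // [|M NM]; first exact: ZZ.
    have [xM ->] := NP _ NM; rewrite -mulrA xM mulr0; split=> //.
    by rewrite -[LHS]/(s * _) mulr_sumr; apply: eq_bigr => n _; rewrite mulrA.
  by exists x; split=> [n|z /GZ/xP]; [rewrite (xP _ _ (GE n))|].
exists g; split=> [A B C CE|A A0|n].
- apply/eqP; rewrite -subr_eq0; apply/eqP/ess => [n|z Zz]; have [gA ZA] := gP A;
    have [gB ZB] := gP B; have [gC ZC] := gP C; rewrite mulrBr mulrA.
    by rewrite gA gC CE; case: (A n); rewrite ?mul0r ?gB subrr.
  by rewrite ZA // ZC // mul0r subrr.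
- have [gA ZA] := gP A; apply: ess => // n.
  by rewrite gA (negbTE (A0 n)).
- move=> gn; have [/(_ n)] := gP (pred1 n); rewrite gn mulr0 /= eqxx => En _.
  by apply: (hne n); apply/eqP; rewrite -subr_eq0 -/(E n) -En.
Qed.

(* Osofsky: with [J] the union of the [R g([0, N))], extend to [R] the homomorphism
   [A + B -> R / J] that is the projection on [R g A] and [0] on [R g B], for [A]
   contained in finitely many fibres of [v] up to a finite set, and [B] meeting
   every fibre of [v] in a finite set. The value at [1] must act as the identity at
   almost all points of every fibre, but as [0] at almost all points of a
   transversal of the fibres. *)
Lemma Osofsky_contradiction : False.
Proof.
have [g [gI g0 g1]] := subset_idempotents.
(* The 2-adic valuation of [n + 1] has infinitely many fibres, all infinite; the shift avoids
   [0]. *)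
pose v n := logn 2 n.+1.
have vfib j N : exists2 n, (N <= n)%N & v n = j.
  exists (2 ^ j * N.*2.+1).-1.
    rewrite -ltnS prednK ?muln_gt0 ?expn_gt0 //.
    apply: leq_trans (leq_pmull _ _); last by rewrite expn_gt0.
    by rewrite ltnS -addnn leq_addr.
  rewrite /v prednK ?muln_gt0 ?expn_gt0 // lognM ?expn_gt0 // pfactorK //.
  by rewrite (@logn_coprime 2 _.+1) ?coprime2n /= ?odd_double // addn0.
pose below N n := (n < N)%N.
pose J (y : R) := exists N, y * g (below N) = y.
have gS (A B : nat -> bool) : (forall n, A n -> B n) -> g A * g B = g A.
  by move=> AB; apply: gI => n; case: (boolP (A n)) => // /AB ->.
have gleq (y : R) (A B : nat -> bool) :
    (forall n, A n -> B n) -> y * g A = y -> y * g B = y.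
  by move=> AB yA; rewrite -yA -mulrA gS.
have glUl (y : R) (A B : nat -> bool) : y * g A = y -> y * g (fun n => A n || B n) = y.
  by apply: gleq => n ->.
have glUr (y : R) (A B : nat -> bool) : y * g B = y -> y * g (fun n => A n || B n) = y.
  by apply: gleq => n ->; rewrite orbT.
have belowS M N : (M <= N)%N -> forall n, below M n -> below N n.
  by move=> MN n nM; apply: leq_trans MN.
have JD x y : J x -> J y -> J (x + y).
  move=> [N xN] [N' yN]; exists (maxn N N'); rewrite mulrDl.
  rewrite (gleq x _ _ (belowS N _ (leq_maxl _ _)) xN).
  by rewrite (gleq y _ _ (belowS N' _ (leq_maxr _ _)) yN).
have JZ s x : J x -> J (s * x) by move=> [N xN]; exists N; rewrite -mulrA xN.
have J0 : J 0 by exists 0%N; rewrite mul0r.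
have JN x : J x -> J (- x) by rewrite -mulN1r; apply: JZ.
have [x|x y|x y z|x x' y y'|s x x'|M [p [pS pE]]] :=
  @quotient_exists R R^o (fun x y : R => J (x - y)).
- by rewrite subrr.
- by move=> /JN; rewrite opprB.
- by move=> xy /(JD _ _ xy); rewrite addrA subrK.
- by move=> xx' /(JD _ _ xx'); rewrite addrACA -opprD.
- by move=> /(JZ s); rewrite mulrBr.
have Minj : e_injective M by apply: cyc; exists p.
pose K (A : nat -> bool) := exists m N, forall n, A n -> (N <= n)%N -> (v n < m)%N.
pose K' (B : nat -> bool) :=
  forall m, exists N, forall n, B n -> (v n < m)%N -> (n < N)%N.
have KU (A B : nat -> bool) : K A -> K B -> K (fun n => A n || B n).
  move=> [m [N AN]] [m' [N' BN]]; exists (maxn m m'), (maxn N N') => n.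
  rewrite geq_max leq_max => /orP[An|Bn] /andP[Nn Nn'].
    by rewrite AN.
  by rewrite BN ?orbT.
have K'U (A B : nat -> bool) : K' A -> K' B -> K' (fun n => A n || B n).
  move=> KA KB m; have [N AN] := KA m; have [N' BN] := KB m.
  exists (maxn N N') => n /orP[An|Bn] vm; rewrite leq_max.
    by rewrite AN.
  by rewrite BN ?orbT.
(* Sets in [K] and in [K'] have finite intersection, which makes the homomorphism well defined
   modulo [J]. *)
have KK' (A B : nat -> bool) :
    K A -> K' B -> forall y : R, y * g A = y -> y * g B = y -> J y.
  move=> [m [N AN]] /(_ m)[N' BN] y yA yB; exists (maxn N N').
  have yAB : y * g (fun n => A n && B n) = y by rewrite -(gI A B) // mulrA yA yB.
  apply: gleq yAB => n /andP[An Bn]; rewrite /below leq_max.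
  by case: (ltnP n N) => //= Nn; apply: BN => //; apply: AN.
have K0 : K pred0 by exists 0%N, 0%N.
have K'0 : K' pred0 by move=> m; exists 0%N.
pose G (y : R) (m : M) := exists k k' A B,
  [/\ K A, K' B, k * g A = k, k' * g B = k' & y = k + k' /\ m = p (k : R^o)].
have [|y m m'|y y' m m'|s y m|m0 m0P] := @Baer M G Minj.
- exists (p 0), 0, 0, pred0, pred0; rewrite !mul0r addr0; split=> //.
- move=> [k [k' [A [B [KA KB kA kB [-> ->]]]]]] [l [l' [C [D [KC KD lC lD [E ->]]]]]].
  apply/pE; apply: (KK' _ _ (KU _ _ KA KC) (K'U _ _ KB KD)).
    by rewrite mulrBl (glUl k A C kA) (glUr l A C lC).
  have -> : k - l = l' - k'.
    by apply/eqP; rewrite subr_eq addrAC eq_sym subr_eq addrC -E addrC.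
  by rewrite mulrBl (glUr l' B D lD) (glUl k' B D kB).
- move=> [k [k' [A [B [KA KB kA kB [-> ->]]]]]] [l [l' [C [D [KC KD lC lD [-> ->]]]]]].
  exists (k + l), (k' + l'), (fun n => A n || C n), (fun n => B n || D n).
  rewrite addrACA -linearD; split=> //; [exact: KU|exact: K'U|..].
    by rewrite mulrDl (glUl k A C kA) (glUr l A C lC).
  by rewrite mulrDl (glUl k' B D kB) (glUr l' B D lD).
- move=> [k [k' [A [B [KA KB kA kB [-> ->]]]]]].
  exists (s * k), (s * k'), A, B; rewrite -!mulrA kA kB mulrDr; split=> //.
  by split=> //; rewrite -linearZ.
have [x xE] := pS m0.
have pM (y : R) : y *: m0 = p (y * x : R) by rewrite -xE -linearZ.
have gg A : g A * g A = g A by apply: gS.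
have xK A : K A -> J (g A - g A * x).
  move=> KA; apply/pE; rewrite -pM; apply: m0P.
  exists (g A), 0, A, pred0; rewrite gg mul0r addr0; split=> //.
have xK' B : K' B -> J (0 - g B * x).
  move=> KB; apply/pE; rewrite -pM; apply: m0P.
  by exists 0, (g B), pred0, B; rewrite gg mul0r add0r.
have Jpred1 y : J y -> exists N, forall n, (N <= n)%N -> y * g (pred1 n) = 0.
  move=> [N yN]; exists N => n Nn; rewrite -yN -mulrA (gI _ _ pred0) => [|k].
    by rewrite g0 ?mulr0.
  by rewrite /= /below; case: eqP => [->|]; rewrite ?andbF // ltnNge Nn.
(* [t] picks in each fibre a point where [x] acts as the identity; [j <= t j] takes the transversal
   beyond any bound. *)
have /choice[t tP] j :
    exists n, [/\ (j <= n)%N, v n = j & g (pred1 n) * x * g (pred1 n) = g (pred1 n)].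
  have [|N NP] := Jpred1 _ (xK (fun n => v n == j) _).
    by exists j.+1, 0%N => n /eqP ->.
  have [n + vn] := vfib j (maxn N j); rewrite geq_max => /andP[Nn jn].
  exists n; split=> //; have /(congr1 (fun z => g (pred1 n) * z)) := NP n Nn.
  rewrite mulr0 mulrBl mulrBr mulrA !mulrA gS => [|k /eqP -> /=]; last by rewrite vn.
  by rewrite gg => /eqP; rewrite subr_eq0 => /eqP <-.
(* The set is the range of [t], with one point in each fibre; beyond [N], [x] acts as [0] on it, in
   particular at [t N]. *)
have [|N NP] := Jpred1 _ (xK' (fun n => n == t (v n)) _).
  move=> m; exists (\max_(j < m) (t j).+1) => n /eqP nE vm.
  rewrite {1}nE.
  exact: (@leq_bigmax_cond _ xpredT (fun j : 'I_m => (t j).+1) (Ordinal vm)).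
have [Nt vt gt] := tP N; apply: (g1 (t N)).
have /(congr1 (fun z => g (pred1 (t N)) * z)) := NP _ Nt.
rewrite mulr0 sub0r mulNr mulrN !mulrA gS ?gt => [|k /eqP -> /=]; last by rewrite vt.
by move/eqP; rewrite oppr_eq0 => /eqP.
Qed.

End Osofsky.

Lemma cyclic_injective_division_corner : 1 <> 0 :> R ->
  exists e : R, [/\ e <> 0, e * e = e &
    forall s, e * s * e <> 0 -> exists t, t * (e * s * e) = e].
Proof.
move=> one_neq0; apply: contrapT => ne.
apply: (Osofsky_contradiction one_neq0) => e ee e0.
apply: contrapT => ns; apply: ne; exists e; split=> // s s0.
apply: contrapT => nt; apply: ns; exists s; split=> // t tE.
by apply: nt; exists t.
Qed.

End CyclicInjective.

(** * The classification and its converse *)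

Lemma simple_neq01 (S : pzSemiRingType) : simple S -> 1 <> 0 :> S.
Proof.
move=> [_ [_ ne]] S0; apply: ne; apply/seteqP; split=> // x _.
by rewrite /= -[x]mulr1 S0 mulr0.
Qed.

Lemma cyclic_regular (S : pzSemiRingType) : cyclic (S^o : lSemiModType S).
Proof. by exists idfun => m; exists m. Qed.

Lemma cyclic_finitely_generated (S : pzSemiRingType) (M : lSemiModType S) :
  cyclic M -> finitely_generated M.
Proof.
case=> p pS; have [x y|s x|k kE] :=
  @linear_exists S 'rV[S]_1 S^o (fun x : 'rV[S]_1 => x ord0 ord0 : S^o).
- by rewrite mxE.
- by rewrite mxE.
exists 1%N, (p \o k) => m; have [s <-] := pS m.
by exists (const_mx s); rewrite /= kE mxE.
Qed.

Lemma cyclic_e_injective_classification (S : pzSemiRingType) :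
  simple S -> (forall M : lSemiModType S, cyclic M -> e_injective M) ->
  (exists (D : nzRingType) (n : nat),
     division_ring D /\ (0 < n)%N /\ semiring_isomorphic S 'M[D]_n) \/
  (exists (d : Order.disp_t) (L : finTBDistrLatticeType d),
     (exists x : L, x <> Order.bottom) /\ semiring_isomorphic S (End L)).
Proof.
move=> simS cyc; have S1 := simple_neq01 simS.
have [Scong Sid] := simS; have [/pzRing_of_opp[R SR]|idem] := ring_or_idempotent Scong.
  left; subst S; have [e [e0 ee ediv]] := cyclic_injective_division_corner cyc S1.
  have [n [u [v full]]] := full_cornerP Sid e0.
  exact: (@division_corner_matrix R e n u v).
right; have [w wtop] := e_injective_top idem (cyc _ (cyclic_regular S)).
have w0 : w <> 0 by move=> w0; apply: S1; rewrite -[1]addr0 -w0 wtop.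
have [n [u [v full]]] := full_cornerP Sid w0.
apply: (@boolean_corner_End S w n u v); split=> // s.
have [s0|s0] := pselect (s = 0); [left|right]; first by rewrite s0 mulr0 mul0r.
have le_trans (x y z : S) : x + y = y -> y + z = z -> x + z = z.
  by move=> xy yz; rewrite -yz addrA xy.
have leM (x x' y y' : S) : x + x' = x' -> y + y' = y' -> x * y + x' * y' = x' * y'.
  move=> xx' yy'; apply: (le_trans _ (x * y')); first by rewrite -mulrDr yy'.
  by rewrite -mulrDl xx'.
have ww : w * w = w.
  by have := leM w w 1 w (idem w) (wtop 1); rewrite mulr1 addrC wtop.
have [m [a [b one_sum]]] := full_cornerP Sid s0.
have le1 : 1 + w * s * w = w * s * w.
  rewrite {1}one_sum; elim/big_ind: _ => [|x y xs ys|i _]; first exact: add0r.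
    by rewrite -addrA ys xs.
  by apply: (leM) => //; apply: (leM).
(* With [x <= y] for [x + y = y]: [w = w * 1 <= w * (w * s * w) = w * s * w <= w]. *)
have := leM w w 1 (w * s * w) (idem w) le1.
by rewrite mulr1 !mulrA ww addrC wtop.
Qed.

Lemma classification_e_injective (S : pzSemiRingType) :
  (exists (D : nzRingType) (n : nat),
     division_ring D /\ (0 < n)%N /\ semiring_isomorphic S 'M[D]_n) \/
  (exists (d : Order.disp_t) (L : finTBDistrLatticeType d),
     (exists x : L, x <> Order.bottom) /\ semiring_isomorphic S (End L)) ->
  simple S /\ forall M : lSemiModType S, finitely_generated M -> e_injective M.
Proof.
case=> [[D [n [Ddiv [n0 iso]]]]|[d [L [L0 iso]]]].
  have [e [m [u [v dc]]]] := division_corner_transport (semiring_isomorphic_sym iso)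
    (matrix_division_corner Ddiv n0).
  have [R SR] : exists R : pzRingType, S = R :> pzSemiRingType.
    apply: pzRing_of_opp; have [f [g fK gK]] := iso; exists (g (-1)).
    by apply: (can_inj fK); rewrite rmorphD rmorph0 rmorph1 gK subrr.
  subst S; split=> [|M _]; first exact: division_corner_simple dc.
  exact: division_corner_e_injective dc M.
have [e [n [u [v bc]]]] := boolean_corner_transport (semiring_isomorphic_sym iso)
  (End_boolean_corner L0).
split=> [|M]; first exact: boolean_corner_simple bc.
exact: boolean_corner_e_injective bc M.
Qed.

Theorem theorem6p10 (S : pzSemiRingType) :
  ((simple S /\
      forall M : lSemiModType S, finitely_generated M -> e_injective M)
   <->
   (simple S /\
      forall M : lSemiModType S, cyclic M -> e_injective M))
  /\
  ((simple S /\
      forall M : lSemiModType S, cyclic M -> e_injective M)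
   <->
   ((exists (D : nzRingType) (n : nat),
       division_ring D /\ (0 < n)%N /\ semiring_isomorphic S 'M[D]_n)
    \/
    (exists (d : Order.disp_t) (L : finTBDistrLatticeType d),
       (exists x : L, x <> Order.bottom) /\ semiring_isomorphic S (End L)))).
Proof.
have fg_cyclic : simple S /\
      (forall M : lSemiModType S, finitely_generated M -> e_injective M) ->
    simple S /\ forall M : lSemiModType S, cyclic M -> e_injective M.
  by move=> [simS fg]; split=> // M /cyclic_finitely_generated/fg.
have cyclic_class :
    simple S /\ (forall M : lSemiModType S, cyclic M -> e_injective M) -> _ :=
  fun H => cyclic_e_injective_classification H.1 H.2.
split; split; [exact: fg_cyclic|by move/cyclic_class/classification_e_injective| |].
  exact: cyclic_class.
by move/classification_e_injective/fg_cyclic.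
Qed.
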